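(* Let $n\ge 3$, $A=(a_1,\dots,a_n)$ positive integers, $\Pi=\prod_{i=1}^n\{0,\dots,a_i\}$. The scheme $\mathring{Y}\subset(\mathbb{C}^\times)^\Pi$ cut out by the equations $$x_{I+e_j+e_\ell}\,x_{I+e_k}=x_I\,x_{I+e_j+e_k+e_\ell}+x_{I+e_j+e_k}\,x_{I+e_\ell}+x_{I+e_k+e_\ell}\,x_{I+e_j}\qquad(1\le j<k<\ell\le n,\ \text{all admissible } I)$$ is an irreducible variety of dimension $\sum_{i<j}a_ia_j+\sum_ia_i+1$. Moreover, if $T$ is any tiling of $P$, then $\{x_J\}_{J\in\mathrm{vert}(T)}$ is a transcendence basis for the coordinate ring of $\mathring{Y}$.
   Context: $C=\prod_{i=1}^n[0,a_i]$ is the cubical complex with vertex set $\Pi$; fix $0<\theta_1<\dots<\theta_n<\pi$, $v_i=(\cos\theta_i,\sin\theta_i)$, $\pi(x)=\sum x_iv_i$, $P=\pi(C)$. A tiling is a two-dimensional subcomplex $T\subset C$ with $\pi|_T:T\to P$ a homeomorphism; $\mathrm{vert}(T)\subset\Pi$ is its vertex set. *)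

(* Defs.v *)
From HB Require Import structures.
From mathcomp Require Import all_boot all_order all_algebra.
From mathcomp Require Import complex.
From mathcomp Require Import all_classical all_reals all_analysis.
From mathcomp Require mpoly.
(* The notations of mpoly clash with those of the analysis library. *)
Import -(notations) mpoly.

Set Implicit Arguments.
Unset Strict Implicit.
Unset Printing Implicit Defensive.

Import Order.TTheory GRing.Theory Num.Theory.
Import numFieldNormedType.Exports.

Local Open Scope classical_set_scope.
Local Open Scope ring_scope.
Local Open Scope quotient_scope.

(* The library quotient {ideal_quot I} asks for a proper ideal; here the ideal
   may be the whole ring, so the quotient is only a comPzRingType (it may be
   the zero ring). *)
Section QuotientByGenerators.
Variables (S : comNzRingType) (G : set S).

Definition ideal_gen : {pred S} := fun p =>
  `[< exists s : seq (S * S),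
        (forall cg, cg \in s -> G cg.2) /\ p = \sum_(cg <- s) cg.1 * cg.2 >].

Lemma ideal_genMl c p : p \in ideal_gen -> c * p \in ideal_gen.
Proof.
move=> /asboolP[s [sG ->]]; apply/asboolP.
exists [seq (c * cg.1, cg.2) | cg <- s]; split.
  by move=> _ /mapP[cg cgs ->]; exact: (sG cg).
by rewrite big_map mulr_sumr; apply: eq_bigr => cg _ /=; rewrite mulrA.
Qed.

Lemma ideal_gen_zmod_closed : zmod_closed ideal_gen.
Proof.
have D p q : p \in ideal_gen -> q \in ideal_gen -> p + q \in ideal_gen.
  move=> /asboolP[s [sG ->]] /asboolP[t [tG ->]]; apply/asboolP.
  exists (s ++ t); rewrite big_cat; split=> // cg.
  by rewrite mem_cat => /orP[/sG|/tG].
split; first by apply/asboolP; exists [::]; rewrite big_nil; split.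
by move=> p q pI qI; apply: D => //; rewrite -mulN1r; apply: ideal_genMl.
Qed.

HB.instance Definition _ :=
  GRing.isZmodClosed.Build S ideal_gen ideal_gen_zmod_closed.

Definition gquot : Type := Quotient.quot (ideal_gen : zmodClosed S).

HB.instance Definition _ := GRing.Zmodule.on gquot.
HB.instance Definition _ :=
  EqQuotient.copy gquot (Quotient.quot (ideal_gen : zmodClosed S)).

Definition gquot_one : gquot := \pi_gquot 1.
Definition gquot_mul (x y : gquot) : gquot := \pi_gquot (repr x * repr y).

Lemma gquot_eqP (x y : S) : \pi_gquot x = \pi_gquot y <-> x - y \in ideal_gen.
Proof.
by rewrite (Quotient.idealrBE (ideal_gen : zmodClosed S)); split=> /eqP.
Qed.

Lemma gquot_piM : {morph \pi_gquot : x y / x * y >-> gquot_mul x y}.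
Proof.
move=> x y; apply/gquot_eqP.
rewrite -[_ * _](addrNK (x * repr (\pi_gquot y))) -mulrBr -addrA -mulrBl.
apply: rpredD; last rewrite mulrC; apply: ideal_genMl; apply/gquot_eqP.
  by rewrite reprK.
by rewrite reprK.
Qed.

Lemma gquot_piD : {morph \pi_gquot : x y / x + y}.
Proof.
by move=> x y; exact: (raddfD (\pi_(Quotient.quot (ideal_gen : zmodClosed S)))).
Qed.

Lemma gquot_mulA : associative gquot_mul.
Proof.
elim/quotW=> x; elim/quotW=> y; elim/quotW=> z.
by rewrite -[gquot_mul (\pi y) _]gquot_piM -[gquot_mul (\pi x) (\pi y)]gquot_piM
           -!gquot_piM mulrA.
Qed.

Lemma gquot_mulC : commutative gquot_mul.
Proof. by move=> x y; rewrite /gquot_mul mulrC. Qed.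

Lemma gquot_mul1 : left_id gquot_one gquot_mul.
Proof. by elim/quotW=> x; rewrite -gquot_piM mul1r. Qed.

Lemma gquot_mulDl : left_distributive gquot_mul +%R.
Proof.
elim/quotW=> x; elim/quotW=> y; elim/quotW=> z.
by rewrite -gquot_piD -!gquot_piM -gquot_piD mulrDl.
Qed.

HB.instance Definition _ := GRing.Zmodule_isComPzRing.Build gquot
  gquot_mulA gquot_mulC gquot_mul1 gquot_mulDl.

Definition gquot_pi (p : S) : gquot := \pi_gquot p.

Lemma gquot_pi_zmod_morphism : zmod_morphism gquot_pi.
Proof.
by move=> x y; exact: (raddfB (\pi_(Quotient.quot (ideal_gen : zmodClosed S)))).
Qed.

Lemma gquot_pi_monoid_morphism : monoid_morphism gquot_pi.
Proof. by split=> // x y; exact: gquot_piM. Qed.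

HB.instance Definition _ :=
  GRing.isZmodMorphism.Build S gquot gquot_pi gquot_pi_zmod_morphism.
HB.instance Definition _ :=
  GRing.isMonoidMorphism.Build S gquot gquot_pi gquot_pi_monoid_morphism.

End QuotientByGenerators.

Section AffineSchemes.
Variable A : comPzRingType.

Definition integral_domain : Prop :=
  (1 : A) <> 0 /\ forall x y : A, x * y = 0 -> x = 0 \/ y = 0.

Definition prime_ideal (p : set A) : Prop :=
  [/\ p 0, forall x y, p x -> p y -> p (x + y), forall x y, p y -> p (x * y),
      ~ p 1 & forall x y, p (x * y) -> p x \/ p y].

Definition prime_chain (d : nat) (p : nat -> set A) : Prop :=
  (forall i, (i <= d)%N -> prime_ideal (p i)) /\
  (forall i, (i < d)%N -> p i `<` p i.+1).

Definition krull_dim_eq (d : nat) : Prop :=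
  (exists p, prime_chain d p) /\
  (forall m p, prime_chain m p -> (m <= d)%N).

End AffineSchemes.

Section TranscendenceBasis.
Variables (K : fieldType) (A : comPzRingType) (iota : {rmorphism K -> A}).
Variables (V : finType) (x : V -> A).

(* The library's mmap, restated because it does not allow the zero ring. *)
Definition mp_eval (p : mpoly #|V| K) : A :=
  \sum_(m <- msupp p)
     iota (mcoeff m p) * \prod_(i < #|V|) x (enum_val i) ^+ m i.

Definition alg_independent : Prop :=
  forall p : mpoly #|V| K, mp_eval p = 0 -> p = 0.

(* f is a root of a nonzero polynomial with coefficients in the subalgebra
   generated by the family x; the coefficient of degree i is mp_eval (q i). *)
Definition algebraic_over (f : A) : Prop :=
  exists (d : nat) (q : 'I_d -> mpoly #|V| K),
    (exists i, mp_eval (q i) <> 0) /\ \sum_(i < d) mp_eval (q i) * f ^+ i = 0.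

Definition transcendence_basis : Prop :=
  alg_independent /\ forall f : A, algebraic_over f.

End TranscendenceBasis.

Section CubicalComplex.
Variables (n : nat) (a : 'I_n -> nat).

Definition grid := {dffun forall i : 'I_n, 'I_(a i).+1}.

(* I + \sum_(i in D) e_i is again a grid point; this is what makes the value
   of inord below meaningful. *)
Definition fits (I : grid) (D : {set 'I_n}) : bool :=
  [forall i in D, (I i < a i)%N].

Definition grid_shift (I : grid) (D : {set 'I_n}) : grid :=
  [ffun i : 'I_n => inord (I i + (i \in D)) : 'I_(a i).+1].

(* When fits I D, (I, D) stands for the cell which is the product over i of
   [I i, I i + 1] if i is in D and of the point I i otherwise. *)
Definition cell := (grid * {set 'I_n})%type.

Definition face (c' c : cell) : bool :=
  (c'.2 \subset c.2) &&
  [exists U : {set 'I_n},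
     (U \subset c.2 :\: c'.2) && (c'.1 == grid_shift c.1 U)].

Definition subcomplex (T : {set cell}) : Prop :=
  (forall c, c \in T -> fits c.1 c.2) /\
  (forall c c', c \in T -> face c' c -> c' \in T).

Definition complex_dim (T : {set cell}) : nat := (\max_(c in T) #|c.2|)%N.

Definition vert (T : {set cell}) : {set grid} :=
  finset (fun J => (J, finset.set0) \in T).

Section Geometry.
Variables (R : realType) (theta : 'I_n -> R).

Definition cell_set (c : cell) : set 'rV[R]_n :=
  [set x : 'rV[R]_n | forall i : 'I_n,
     (i \in c.2 -> (c.1 i)%:R <= x ord0 i <= (c.1 i)%:R + 1) /\
     (i \notin c.2 -> x ord0 i = (c.1 i)%:R)].

Definition realization (T : {set cell}) : set 'rV[R]_n :=
  [set x | exists2 c, c \in T & cell_set c x].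

Definition cube_box : set 'rV[R]_n :=
  [set x : 'rV[R]_n | forall i : 'I_n, 0 <= x ord0 i <= (a i)%:R].

Definition dirvec (t : R) : 'rV[R]_2 :=
  \row_(k < 2) (if k == ord0 then cos t else sin t).

Definition planar_proj (x : 'rV[R]_n) : 'rV[R]_2 :=
  \sum_(i < n) x ord0 i *: dirvec (theta i).

Definition shadow : set 'rV[R]_2 := planar_proj @` cube_box.

Definition homeomorphism_on (E F : topologicalType) (X : set E) (Y : set F)
    (f : E -> F) : Prop :=
  [/\ set_bij X Y f, {within X, continuous f} &
      exists g : F -> E, {in X, cancel f g} /\ {within Y, continuous g}].

Definition tiling (T : {set cell}) : Prop :=
  [/\ subcomplex T, complex_dim T = 2%N &
      homeomorphism_on (realization T) shadow planar_proj].

End Geometry.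
End CubicalComplex.

Section CubeRecurrence.
Variables (R : realType) (n : nat) (a : 'I_n -> nat).

Local Notation N := #|{: grid a}|.

(* C[x_J, y_J : J in the grid]; modulo x_J * y_J = 1 this is the Laurent
   polynomial ring, i.e. the coordinate ring of the torus. *)
Definition ambient := mpoly (N + N) R[i].

Definition xvar (J : grid a) : ambient :=
  mpolyX R[i] (mnm1 (lshift N (enum_rank J))).
Definition yvar (J : grid a) : ambient :=
  mpolyX R[i] (mnm1 (rshift N (enum_rank J))).

Definition cube_eq (I : grid a) (j k l : 'I_n) : ambient :=
  let X (D : {set 'I_n}) := xvar (grid_shift I D) in
  X [set j; l]%SET * X [set k]%SET -
  (X finset.set0 * X [set j; k; l]%SET + X [set j; k]%SET * X [set l]%SET +
   X [set k; l]%SET * X [set j]%SET).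

Definition relations : set ambient :=
  [set p | (exists J : grid a, p = xvar J * yvar J - 1) \/
           (exists (I : grid a) (j k l : 'I_n),
              [/\ (j < k)%N, (k < l)%N, fits I [set j; k; l]%SET
                & p = cube_eq I j k l])].

Definition coord_ring : comPzRingType := gquot relations.

Definition coord_fun (J : grid a) : coord_ring := gquot_pi relations (xvar J).

Definition scalar_map : {rmorphism R[i] -> coord_ring} :=
  gquot_pi relations \o @mpolyC (N + N) R[i].

End CubeRecurrence.

Arguments coord_ring R {n} a.
Arguments coord_fun R {n a} J.
Arguments scalar_map R {n} a.

(* Main.v *)
(* Solving a cube equation for x_{I+e_j+e_k+e_l} determines all x_I from those
   with at most two nonzero coordinates in I, and the equations are consistent:
   on a 4-cube every way of computing the top vertex gives
   x_0 x_1234 = x_12 x_34 - x_13 x_24 + x_14 x_23. None of the resulting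
   rational functions vanishes identically, because
   x_I = prod_{j<k} tan(alpha_k - alpha_j)^(I_j I_k) is a nowhere zero solution
   (addition formula for the tangent). Hence the coordinate ring is, up to
   inverting some elements, a polynomial ring in these
   N = sum_{i<j} a_i a_j + sum_i a_i + 1 variables; this gives integrality and
   the dimension.

   A tiling T is swept from its right boundary to its left boundary by monotone
   paths, one tile at a time. The sweep is a maximal chain of adjacent swaps of
   words, so T has at most N vertices, and by the argument of Matsumoto's
   theorem any two such chains differ by commutations and braid moves, the
   latter being cube flips; hence every x_I is a fraction in the x_J with J a
   vertex of T. A relation among these x_J would allow a chain of N + 2 primes
   in a polynomial ring in at most N variables. *)
Require Import Defs.
From HB Require Import structures.
From mathcomp Require Import all_boot all_order all_algebra.
From mathcomp Require Import complex zify ring lra.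
From mathcomp Require Import all_classical all_reals all_analysis.
From mathcomp Require mpoly.
Import -(notations) mpoly.

Set Implicit Arguments.
Unset Strict Implicit.
Unset Printing Implicit Defensive.

Import Order.TTheory GRing.Theory Num.Theory.

Local Open Scope ring_scope.

(** The coordinate ring is never identified with a localization, and a priori it could even be zero.
    The predicate [fractional] only records that each element becomes, after multiplication by a
    unit, the image of a polynomial. This already carries prime chains down to the polynomial ring;
    integrality needs injectivity of the map as well, and injectivity is tested on complex points.
    The tangent solution is a single such point. Moving the free initial data away from it along a
    line with parameter s turns every x_I into a rational function of s that is regular and nonzero
    at s = 0, so some s keeps all x_I nonzero while a given nonzero polynomial in the initial data
    does not vanish either. Inverting elements could also shorten prime chains. The tangent solution
    helps a second time: no unit vanishes there, so the ideals of a flag of affine subspaces through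
    it survive as primes. On the geometric side all local information comes from small horizontal
    moves: since the angles lie strictly between 0 and pi, no edge is horizontal, and a horizontal
    move from a point of the tiling must enter the interior of a tile direction pair. *)

(** * Lengths of prime chains in polynomial rings over a field *)

Section PrimeChains.

Lemma linear_dependence (K : fieldType) (m d : nat) (v : 'I_m -> 'rV[K]_d) :
  (d < m)%N -> exists2 c : 'I_m -> K, exists i, c i != 0 & \sum_i c i *: v i = 0.
Proof.
move=> ltdm; pose W := \matrix_i v i.
have : kermx W != 0.
  rewrite -mxrank_eq0 mxrank_ker subn_eq0 -ltnNge.
  exact: leq_ltn_trans (rank_leq_col W) ltdm.
case/rowV0Pn=> u uW /eqP u0; exists (u ord0).
  have [i ui|u00] := pickP (fun i => u ord0 i != 0); first by exists i.
  by case: u0; apply/rowP=> i; rewrite mxE; apply/eqP/negbFE/u00.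
have := sub_kermxP uW; rewrite mulmx_sum_row => uW0.
by rewrite -[RHS]uW0; apply: eq_bigr => i _; rewrite rowK.
Qed.

Fixpoint exponents (M m : nat) : seq (seq nat) :=
  if m is m'.+1 then [seq e :: s | e <- iota 0 M, s <- exponents M m']
  else [:: [::]].

Lemma size_exponents M m : size (exponents M m) = (M ^ m)%N.
Proof. by elim: m => //= m IH; rewrite size_allpairs size_iota IH expnS. Qed.

Lemma uniq_exponents M m : uniq (exponents M m).
Proof.
elim: m => //= m IH; apply: allpairs_uniq => //; first exact: iota_uniq.
by move=> [e s] [e' s'] _ _ /= [-> ->].
Qed.

Lemma mem_exponents_cons M m e s :
  (e :: s \in exponents M m.+1) = (e < M)%N && (s \in exponents M m).
Proof.
apply/allpairsP/andP => [[[e' s'] /= [ei si [-> ->]]]|[eM si]].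
  by move: ei; rewrite mem_iota.
by exists (e, s); rewrite /= mem_iota.
Qed.

(** Exponents are read from a list and [z] is shifted, so that the first variable can be split off
    by induction on the number of variables. *)
Fixpoint monomial_at (A : pzSemiRingType) (z : nat -> A) (s : seq nat) : A :=
  if s is e :: s' then z 0 ^+ e * monomial_at (fun i => z i.+1) s' else 1.

Variables (K : fieldType) (r : nat).
Notation B := (mpoly r K).

Lemma msizeM_leq (p q : B) : (msize (p * q) <= (msize p + msize q).-1)%N.
Proof.
have [->|p0] := eqVneq p 0; first by rewrite mul0r msize0.
have [->|q0] := eqVneq q 0; first by rewrite mulr0 msize0.
by rewrite msizeM.
Qed.

Lemma msize_exp_le (z : B) D e : (msize z <= D.+1 -> msize (z ^+ e) <= (D * e).+1)%N.
Proof.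
move=> zD; elim: e => [|e IH]; first by rewrite expr0 msize1.
rewrite exprS; apply: leq_trans (msizeM_leq _ _) _.
by rewrite mulnS; lia.
Qed.

Lemma msize_monomial_at M D m (z : nat -> B) s :
  (forall i, (i < m)%N -> (msize (z i) <= D.+1)%N) -> s \in exponents M m ->
  (msize (monomial_at z s) <= (m * (D * M)).+1)%N.
Proof.
elim: m z s => [|m IH] z s zD.
  by rewrite inE => /eqP ->; rewrite /= msize1.
case: s => [|e s]; first by case/allpairsP=> -[e s] [].
rewrite mem_exponents_cons => /andP[eM sM] /=.
have h1 := msize_exp_le e (zD 0 isT).
have h2 := IH (fun i => z i.+1) s (fun i im => zD i.+1 im) sM.
apply: leq_trans (msizeM_leq _ _) _; rewrite mulSn.
have : (D * e <= D * M)%N by rewrite leq_mul2l (ltnW eM) orbT.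
by lia.
Qed.

(** A count: r + 1 polynomials have M^(r+1) monomials with exponents below M, but the degrees of
    these grow only linearly in M, so they lie in a space whose dimension grows like M^r. *)
Lemma mpolys_dependent (z : nat -> B) :
  exists M (c : seq nat -> K),
    (exists2 s, s \in exponents M r.+1 & c s != 0) /\
    \sum_(s <- exponents M r.+1) c s *: monomial_at z s = 0.
Proof.
pose D := (\max_(i < r.+1) msize (z i))%N.
have zD i : (i < r.+1)%N -> (msize (z i) <= D.+1)%N.
  by move=> ir; apply: leqW; exact: (@leq_bigmax _ (fun i : 'I_r.+1 => msize (z i)) (Ordinal ir)).
(* Each monomial has size at most [L], so [L ^ r] coefficients describe it. The choice of [M] just
   above [E ^ r] is what makes [L ^ r] smaller than [M ^ r.+1]. *)
pose E := (r.+1 * D).+1; pose M := (E ^ r).+1; pose L := (E * M)%N.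
pose X := {ffun 'I_r -> 'I_L}.
pose mn (f : X) : multinom r := Multinom [tuple (f i : nat) | i < r].
pose ws := exponents M r.+1.
pose vec (b : B) : 'rV[K]_#|{: X}| := \row_j mcoeff (mn (enum_val j)) b.
have ltXM : (#|{: X}| < size ws)%N.
  rewrite size_exponents card_ffun !card_ord /L expnMn expnS ltn_mul2r.
  by rewrite expn_gt0 /= ltnS.
have [c [i ci] c0] := linear_dependence (fun i : 'I_(size ws) => vec (monomial_at z (nth [::] ws i))) ltXM.
pose c' s := \sum_(i < size ws | nth [::] ws i == s) c i.
have c'E (i0 : 'I_(size ws)) : c' (nth [::] ws i0) = c i0.
  rewrite /c' (big_pred1 i0) // => j /=.
  by rewrite nth_uniq ?uniq_exponents.
exists M, c'; split; first by exists (nth [::] ws i); rewrite ?mem_nth ?c'E.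
rewrite (big_nth [::]) big_mkord; under eq_bigr do rewrite c'E.
set P := \sum_(_ < _) _.
have Psz : (msize P <= L)%N.
  rewrite /P; elim/big_ind: _ => [|p q pL qL|j _]; first by rewrite msize0.
    by apply: leq_trans (mmeasureD_le _ _ _) _; rewrite geq_max pL.
  apply: leq_trans (msizeZ_le _ _) _.
  apply: leq_trans (msize_monomial_at zD (mem_nth _ (ltn_ord j))) _.
  by rewrite /L /E mulSn mulnA; lia.
apply/mpolyP => m; rewrite mcoeff0; apply/eqP; apply: contraT => Pm.
have mL j : (m j < L)%N.
  apply: leq_trans Psz; rewrite -mcoeff_msupp in Pm.
  apply: leq_ltn_trans (msize_mdeg_lt Pm).
  by rewrite mdegE (bigD1 j) //= leq_addr.
pose f : X := [ffun j => Ordinal (mL j)].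
have mf : m = mn f by apply/mnmP => j; rewrite [RHS]mnm_tnth tnth_mktuple ffunE.
have := congr1 (fun v : 'rV_ _ => v ord0 (enum_rank f)) c0.
rewrite summxE mxE => {}c0; rewrite -c0 mf /P raddf_sum /= in Pm.
move/negP: Pm; case; apply/eqP; apply: eq_bigr => j _.
by rewrite !mxE enum_rankK mcoeffZ.
Qed.

Lemma sum_exponents_cons (c : seq nat -> K) M m (z : nat -> B) :
  \sum_(s <- exponents M m.+1) c s *: monomial_at z s =
  \sum_(0 <= e < M) z 0 ^+ e * \sum_(s <- exponents M m)
     c (e :: s) *: monomial_at (fun i => z i.+1) s.
Proof.
rewrite /= big_allpairs_dep /= /index_iota subn0; apply: eq_bigr => e _.
by rewrite mulr_sumr; apply: eq_bigr => s _; rewrite /= scalerAr.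
Qed.

(* The lowest power of z_0 with a nonzero coefficient can be cancelled modulo
   p_0, and the remaining multiples of z_0 vanish modulo p_1. *)
Lemma chain_independent M m (p : nat -> set B) (z : nat -> B) (c : seq nat -> K) :
  prime_chain m p ->
  (forall i, (i < m)%N -> p i.+1 (z i) /\ ~ p i (z i)) ->
  p 0%N (\sum_(s <- exponents M m) c s *: monomial_at z s) ->
  forall s, s \in exponents M m -> c s = 0.
Proof.
elim: m p z c => [|m IH] p z c [prp lep] zp.
  rewrite big_seq1 /= => p0 s; rewrite inE => /eqP ->.
  apply/eqP; apply: contraT => c0; have [_ _ pM p1 _] := prp 0%N isT.
  case: p1; have := pM ((c [::])^-1 *: 1) _ p0.
  by rewrite -scalerAl mul1r scalerA mulVf // scale1r.
rewrite sum_exponents_cons.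
pose g e := \sum_(s <- exponents M m) c (e :: s) *: monomial_at (fun i => z i.+1) s.
change (p 0%N (\sum_(0 <= e < M) z 0 ^+ e * g e) ->
  forall s, s \in exponents M m.+1 -> c s = 0) => p0.
have ce e : (e < M)%N -> forall s, s \in exponents M m -> c (e :: s) = 0.
  elim/ltn_ind: e => e IHe eM; apply: (IH (fun i => p i.+1) (fun i => z i.+1)).
  - by split=> i im; [apply: prp | apply: lep].
  - by move=> i im; apply: zp.
  have g0 e' : (e' < e)%N -> g e' = 0.
    move=> e'e; rewrite /g big_seq big1 // => s sM.
    by rewrite (IHe e') // ?scale0r // (ltn_trans e'e).
  have [_ pD pM _ pP] := prp 0%N isT.
  move: p0; rewrite (big_cat_nat (n := e)) //=; last exact: ltnW.
  rewrite big_nat big1 ?add0r; last by move=> i /andP[_ ie]; rewrite g0 ?mulr0.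
  rewrite big_ltn //.
  have -> : \sum_(e.+1 <= i < M) z 0 ^+ i * g i =
     z 0 ^+ e * (z 0 * \sum_(e.+1 <= i < M) z 0 ^+ (i - e.+1) * g i).
    rewrite mulrA -exprSr mulr_sumr; apply: eq_big_nat => i /andP[ei _].
    by rewrite mulrA -exprD subnKC.
  rewrite -mulrDr; set h := \sum_(_ <= _ < _) _ => pe.
  have [p1z p0z] := zp 0%N isT.
  have {pe} : p 0%N (g e + z 0 * h).
    have nz k : ~ p 0%N (z 0 ^+ k).
      elim: k => [|k IHk]; first by have [_ _ _ n1 _] := prp 0%N isT.
      by rewrite exprS => /pP[].
    by case: (pP _ _ pe) => // /nz.
  have [lep01 _] := lep 0%N isT; move=> /lep01 p1g.
  have [_ qD qM _ _] := prp 1%N isT.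
  change (p 1%N (g e)).
  rewrite -(addrK (z 0 * h) (g e)); apply: qD => //.
  by rewrite -mulrN mulrC; apply: qM.
case=> [|e s]; first by case/allpairsP=> -[e s] [].
by rewrite mem_exponents_cons => /andP[eM]; apply: ce.
Qed.

(** In a longer chain, elements z_i of p_(i+1) outside p_i, for i from 0 to r, would be r + 1
    independent polynomials, against [mpolys_dependent]. *)
Lemma mpoly_prime_chain_le m (p : nat -> set B) : prime_chain m p -> (m <= r)%N.
Proof.
move=> [prp lep]; rewrite leqNgt; apply/negP => rm.
have [z zp] : exists z : nat -> B, forall i, (i < r.+1)%N -> p i.+1 (z i) /\ ~ p i (z i).
  have /choice[z zp] : forall i, exists z : B, (i < r.+1)%N -> p i.+1 z /\ ~ p i z.
    move=> i; have [ir|] := boolP (i < r.+1)%N; last by exists 0.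
    have [_ /existsNP[z /not_implyP[pz npz]]] := lep i (leq_trans ir rm).
    by exists z.
  by exists z.
have [M [c [[s sM /eqP cs] c0]]] := mpolys_dependent z.
have ch : prime_chain r.+1 p.
  by split=> i ir; [apply: prp | apply: lep]; apply: leq_trans ir rm.
apply: cs; apply: (chain_independent ch zp) sM.
by rewrite c0; have [] := prp 0%N isT.
Qed.

End PrimeChains.

(** * Rings of fractions of a polynomial ring: integrality and dimension *)

Section Fractions.
Variables (K : fieldType) (r : nat) (A : comPzRingType).
Notation B := (mpoly r K).
Variable psi : {rmorphism B -> A}.

(** Stands in for membership in a localization: the denominator only has to become a unit in [A],
    and [psi] is allowed to have a kernel. *)
Definition fractional (al : A) : Prop :=
  exists c b : B, (exists u, psi c * u = 1) /\ psi c * al = psi b.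

Lemma fractional_image b : fractional (psi b).
Proof. by exists 1, b; rewrite rmorph1; split; [exists 1|]; rewrite mul1r. Qed.

Lemma fractionalM al be : fractional al -> fractional be -> fractional (al * be).
Proof.
move=> [c [b [[u cu] cal]]] [c' [b' [[u' cu'] cbe]]]; exists (c * c'), (b * b').
rewrite !rmorphM; split; last by rewrite -cal -cbe mulrACA.
by exists (u * u'); rewrite mulrACA cu cu' mulr1.
Qed.

Lemma fractionalD al be : fractional al -> fractional be -> fractional (al + be).
Proof.
move=> [c [b [[u cu] cal]]] [c' [b' [[u' cu'] cbe]]].
exists (c * c'), (c' * b + c * b'); rewrite rmorphD !rmorphM; split.
  by exists (u * u'); rewrite mulrACA cu cu' mulr1.
by rewrite -cal -cbe; ring.
Qed.

Lemma fractionalN al : fractional al -> fractional (- al).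
Proof.
by move=> [c [b [cu cal]]]; exists c, (- b); rewrite mulrN cal rmorphN.
Qed.

Lemma fractional_inv al be : fractional al -> al * be = 1 -> fractional be.
Proof.
move=> [c [b [[u cu] cal]]] ab; exists b, c; split.
  by exists (be * u); rewrite -cal -mulrA (mulrA al) ab mul1r.
by rewrite -cal -mulrA ab mulr1.
Qed.

Hypothesis frac : forall al, fractional al.

(** Strictness survives contraction: an element of the larger prime outside the smaller one is, up
    to a unit, the image of some [b], and this [b] separates the two contractions. *)
Lemma contract_prime_chain m (p : nat -> set A) :
  prime_chain m p -> prime_chain m (fun i => (psi @^-1` p i)%classic).
Proof.
move=> [prp lep]; split=> i im.
  have [p0 pD pM p1 pP] := prp i im; split=> /=.
  - by rewrite rmorph0.
  - by move=> x y; rewrite rmorphD; apply: pD.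
  - by move=> x y; rewrite rmorphM; apply: pM.
  - by rewrite rmorph1.
  - by move=> x y; rewrite rmorphM; apply: pP.
have [le /existsNP[al /not_implyP[pal npal]]] := lep i im.
split; first by move=> x /=; apply: le.
move=> /= sub; have [c [b [[u cu] cal]]] := frac al.
have [_ _ pM _ _] := prp i (ltnW im); have [_ _ qM _ _] := prp _ im.
have := sub b; rewrite /= -cal => /(_ (qM _ _ pal)) /(pM u).
by rewrite mulrA [u * _]mulrC cu mul1r.
Qed.

Lemma fractional_prime_chain_le m (p : nat -> set A) :
  prime_chain m p -> (m <= r)%N.
Proof. by move/contract_prime_chain/mpoly_prime_chain_le. Qed.

(* Otherwise (0) could be added below the contraction of the chain. *)
Lemma long_chain_injective m (p : nat -> set A) :
  prime_chain m p -> (r <= m)%N -> forall b, psi b = 0 -> b = 0.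
Proof.
move=> chp rm b b0; apply/eqP; apply: contraT => bN0.
have [prp lep] := contract_prime_chain chp.
pose q i := if i is i'.+1 then (psi @^-1` p i')%classic else [set 0 : B]%classic.
suff /mpoly_prime_chain_le : prime_chain m.+1 q by rewrite ltnNge rm.
split=> -[|i] im /=; [|exact: prp| |exact: lep].
  split=> //=.
  - by move=> x y -> ->; rewrite addr0.
  - by move=> x y ->; rewrite mulr0.
  - by move/eqP; rewrite oner_eq0.
  - by move=> x y /eqP; rewrite mulf_eq0 => /orP[] /eqP; [left|right].
have [p0 _ _ _ _] := prp 0%N isT; split=> [x /= ->|sub] //.
by case/eqP: bN0; apply: sub; move: p0; rewrite /= b0 rmorph0.
Qed.

Hypothesis inj : forall b, psi b = 0 -> b = 0.

(** Clearing both denominators by units turns a vanishing product in [A] into a vanishing product of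
    numerators in the polynomial ring. *)
Lemma fractional_integral_domain : integral_domain A.
Proof.
split.
  by move=> e; have /eqP := inj (etrans (rmorph1 psi) e); rewrite oner_eq0.
move=> x y xy0; have [c [b [[u cu] cx]]] := frac x.
have [c' [b' [[u' cu'] cy]]] := frac y.
have /inj/eqP : psi (b * b') = 0 by rewrite rmorphM -cx -cy mulrACA xy0 mulr0.
rewrite mulf_eq0 => /orP[]/eqP b0; [left|right].
  by rewrite -[x]mul1r -cu mulrAC cx b0 rmorph0 mul0r.
by rewrite -[y]mul1r -cu' mulrAC cy b0 rmorph0 mul0r.
Qed.

Variable v : 'I_r -> K.
Hypothesis unit_at : forall c u, psi c * u = 1 -> meval v c != 0.

(** The kernel is the ideal of the affine subspace through [v] on which the first [i] coordinates
    are those of [v]. These kernels grow from zero to the maximal ideal of the point [v]. *)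
Definition freeze (i : nat) : B -> B :=
  mmap (@mpolyC r K) (fun k : 'I_r => if (k < i)%N then mpolyC r (v k) else mpolyX K (mnm1 k)).

HB.instance Definition _ i := GRing.RMorphism.on (freeze i).

Lemma meval_freeze i c : meval v (freeze i c) = meval v c.
Proof.
rewrite {2}[c]mpolyE /freeze /mmap !raddf_sum /=; apply: eq_bigr => m _.
rewrite mevalM mevalZ mevalC mevalX; congr (_ * _).
rewrite /mmap1 rmorph_prod; apply: eq_bigr => k _.
by rewrite rmorphXn /=; case: ifP => _; rewrite ?mevalC ?mevalXU.
Qed.

Definition freeze_ideal (i : nat) : set A := fun al =>
  exists c b, [/\ exists u, psi c * u = 1, psi c * al = psi b & freeze i b = 0].

(** The choice of fraction does not matter: two fractions for [al] agree after cross multiplication,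
    and no denominator lies in the kernel of [freeze i], because it does not vanish at [v]. *)
Lemma freeze_idealP i al c b : (exists u, psi c * u = 1) -> psi c * al = psi b ->
  freeze_ideal i al <-> freeze i b = 0.
Proof.
move=> cu cal; split=> [|b0]; last by exists c, b.
move=> [c' [b' [[u' cu'] cal' b'0]]].
have /eqP : c' * b = c * b'.
  apply/eqP; rewrite -subr_eq0; apply/eqP/inj.
  by rewrite rmorphB !rmorphM -cal -cal' mulrCA subrr.
move/eqP/(congr1 (freeze i)); rewrite !rmorphM /= b'0 mulr0 => /eqP.
rewrite mulf_eq0 => /orP[|/eqP //] /eqP c'0.
by have := unit_at cu'; rewrite -(meval_freeze i) c'0 meval0 eqxx.
Qed.

Lemma fractional_chain : exists p : nat -> set A, prime_chain r p.
Proof.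
exists freeze_ideal; split=> i ir.
  split.
  - by apply/(@freeze_idealP _ _ 1 0); rewrite ?rmorph1 ?rmorph0 ?mulr0 //; exists 1; rewrite mulr1.
  - move=> x y; have [c [b [[u cu] cx]]] := frac x.
    have [c' [b' [[u' cu'] cy]]] := frac y.
    rewrite (freeze_idealP _ _ cx); last by exists u.
    rewrite (freeze_idealP _ _ cy); last by exists u'.
    move=> b0 b'0; apply/(@freeze_idealP _ _ (c * c') (c' * b + c * b')).
    + by exists (u * u'); rewrite rmorphM mulrACA cu cu' mulr1.
    + by rewrite rmorphD !rmorphM -cx -cy; ring.
    by rewrite rmorphD !rmorphM /= b0 b'0 !mulr0 addr0.
  - move=> x y; have [c [b [[u cu] cx]]] := frac x.
    have [c' [b' [[u' cu'] cy]]] := frac y.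
    rewrite (freeze_idealP _ _ cy); last by exists u'.
    move=> b'0; apply/(@freeze_idealP _ _ (c * c') (b * b')).
    + by exists (u * u'); rewrite rmorphM mulrACA cu cu' mulr1.
    + by rewrite !rmorphM -cx -cy mulrACA.
    by rewrite rmorphM /= b'0 mulr0.
  - rewrite (@freeze_idealP _ _ 1 1) ?rmorph1 ?mulr1 //; last by exists 1; rewrite mulr1.
    by apply/eqP; rewrite oner_eq0.
  - move=> x y; have [c [b [[u cu] cx]]] := frac x.
    have [c' [b' [[u' cu'] cy]]] := frac y.
    rewrite (freeze_idealP _ _ cy); last by exists u'.
    rewrite (freeze_idealP _ _ cx); last by exists u.
    rewrite (@freeze_idealP _ _ (c * c') (b * b')).
    + by rewrite rmorphM => /eqP; rewrite mulf_eq0 => /orP[]/eqP; [left|right].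
    + by exists (u * u'); rewrite rmorphM mulrACA cu cu' mulr1.
    + by rewrite !rmorphM -cx -cy mulrACA.
have frX j k : freeze j (mpolyX K (mnm1 k)) = if (k < j)%N then mpolyC r (v k) else mpolyX K (mnm1 k).
  by rewrite /freeze mmapX mmap1U.
have frC j k : freeze j (mpolyC r k) = mpolyC r k by rewrite /freeze mmapC.
split.
  move=> x; have [c [b [[u cu] cx]]] := frac x.
  rewrite !(freeze_idealP _ _ cx); try by exists u.
  (* Freezing [i] variables and then [i.+1] is the same as freezing [i.+1] at once, so the kernels
     increase. *)
  move=> /(congr1 (freeze i.+1)); rewrite rmorph0 => b0; rewrite -[RHS]b0.
  rewrite [b]mpolyE (raddf_sum (freeze i)) !(raddf_sum (freeze i.+1)) /=; apply: eq_bigr => m _.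
  rewrite -!mul_mpolyC !rmorphM /= !frC; congr (_ * _).
  rewrite !mpolyXE_id !rmorph_prod; apply: eq_bigr => k _.
  rewrite !rmorphXn /= !frX; congr (_ ^+ _).
  by have [ki|ki] := ltnP k i; rewrite ?frC ?frX ?(leqW ki).
(* The inclusion is strict because of X_k - v_k with k = i: it is killed once the variable of index
   [i] is frozen, and not before. *)
move=> sub; pose k := Ordinal ir; pose d := mpolyX K (mnm1 k) - mpolyC r (v k).
have [u1 e1] : (exists u, psi 1 * u = 1) /\ psi 1 * psi d = psi d.
  by rewrite rmorph1 mul1r; split=> //; exists 1; rewrite mulr1.
have := sub (psi d); rewrite !(freeze_idealP _ u1 e1) /d !rmorphB /= !frX !frC /= ltnSn ltnn.
rewrite subrr => /(_ erefl) /(congr1 (mcoeff (mnm1 k))).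
rewrite mcoeffB mcoeffX mcoeffC eqxx mcoeff0 mnm1_eq0 mulr0 subr0.
by move/eqP; rewrite oner_eq0.
Qed.

Lemma fractional_krull_dim : krull_dim_eq A r.
Proof. by split; [exact: fractional_chain | exact: fractional_prime_chain_le]. Qed.

End Fractions.

(** * Lattice points, shifts along words, supports *)

Section Lattice.
Variable n : nat.
Notation lattice := {ffun 'I_n -> nat}.

Definition shift (I : lattice) (s : seq 'I_n) : lattice :=
  [ffun i => (I i + count_mem i s)%N].
(** The subtraction is truncated, so [shift] undoes it only under the hypothesis of [lowerK]. *)
Definition lower (I : lattice) (s : seq 'I_n) : lattice :=
  [ffun i => (I i - count_mem i s)%N].
Definition weight (I : lattice) : nat := (\sum_i I i)%N.
Definition lsupp (I : lattice) : seq 'I_n := [seq i <- enum 'I_n | (0 < I i)%N].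

Lemma shift0 I : shift I [::] = I.
Proof. by apply/ffunP=> i; rewrite ffunE addn0. Qed.

Lemma shift_cat I s t : shift (shift I s) t = shift I (s ++ t).
Proof. by apply/ffunP=> i; rewrite !ffunE count_cat addnA. Qed.

Lemma shift_perm I s t : perm_eq s t -> shift I s = shift I t.
Proof. by move=> /permP st; apply/ffunP=> i; rewrite !ffunE st. Qed.

Lemma weight_shift I s : weight (shift I s) = (weight I + size s)%N.
Proof.
rewrite /weight; under eq_bigr do rewrite ffunE.
rewrite big_split /=; congr addn; elim: s => [|j s IH] /=.
  by rewrite big1.
rewrite big_split /= IH (bigD1 j) //= eqxx big1 ?add1n //.
by move=> i /negPf; rewrite eq_sym => ->.
Qed.

Lemma lowerK (I : lattice) s : (forall i, (count_mem i s <= I i)%N) -> shift (lower I s) s = I.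
Proof. by move=> sI; apply/ffunP=> i; rewrite !ffunE subnK. Qed.

Lemma mem_lsupp (I : lattice) i : (i \in lsupp I) = (0 < I i)%N.
Proof. by rewrite mem_filter mem_enum andbT. Qed.

Lemma sorted_lsupp I : sorted (fun i j : 'I_n => (i < j)%N) (lsupp I).
Proof.
apply: sorted_filter; first by move=> j i k; apply: ltn_trans.
by have := iota_ltn_sorted 0 n; rewrite -val_enum_ord sorted_map.
Qed.

Lemma uniq_count_le (s : seq 'I_n) (I : lattice) :
  uniq s -> (forall i, i \in s -> (0 < I i)%N) -> forall i, (count_mem i s <= I i)%N.
Proof.
move=> us sI i; rewrite count_uniq_mem //.
by case: (boolP (i \in s)) => // /sI.
Qed.

End Lattice.

(** * The cube relation and its tangent solution *)

Section CubeRelation.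
Variables (n : nat) (K : pzRingType).
Notation lattice := {ffun 'I_n -> nat}.

Definition cube_rel (f : lattice -> K) (I : lattice) (j k l : 'I_n) : Prop :=
  f (shift I [:: j; l]) * f (shift I [:: k]) =
  f I * f (shift I [:: j; k; l]) + f (shift I [:: j; k]) * f (shift I [:: l]) +
  f (shift I [:: k; l]) * f (shift I [:: j]).

End CubeRelation.

Section ExplicitSolution.
Variables (n : nat) (K : numFieldType).
Notation lattice := {ffun 'I_n -> nat}.

(* tan (atan k - atan j) *)
Definition tan_diff (j k : nat) : K := (k%:R - j%:R) / (1 + j%:R * k%:R).

(** The value 1 away from j < k lets products run over all pairs and makes the diagonal exponents
    I_j^2 harmless. The angles are alpha_j = atan j, which keeps all values rational. *)
Definition tan_weight (j k : 'I_n) : K := if (j < k)%N then tan_diff j k else 1.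

Definition tan_solution (I : lattice) : K :=
  \prod_j \prod_k tan_weight j k ^+ (I j * I k).

(** The factor by which [tan_solution] changes when coordinate [a] grows by one; it does not involve
    I_a because the diagonal weight is 1. *)
Definition tan_step (a : 'I_n) (I : lattice) : K :=
  \prod_k (tan_weight a k * tan_weight k a) ^+ (I k).

Lemma tan_denom_neq0 (j k : nat) : 1 + j%:R * k%:R != 0 :> K.
Proof. by rewrite -natrM nat1r pnatr_eq0. Qed.

Lemma tan_diff_neq0 (j k : nat) : (j < k)%N -> tan_diff j k != 0.
Proof.
move=> jk; rewrite mulf_neq0 ?invr_eq0 ?tan_denom_neq0 //.
by rewrite subr_eq0 eqr_nat gtn_eqF.
Qed.

Lemma tan_weight_neq0 j k : tan_weight j k != 0.
Proof. by rewrite /tan_weight; case: ifP => [/tan_diff_neq0|_] //; rewrite oner_eq0. Qed.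

Lemma tan_solution_neq0 I : tan_solution I != 0.
Proof.
by apply/prodf_neq0 => j _; apply/prodf_neq0 => k _; rewrite expf_neq0 ?tan_weight_neq0.
Qed.

Lemma tan_solution_shift1 I a :
  tan_solution (shift I [:: a]) = tan_solution I * tan_step a I.
Proof.
have -> : tan_solution (shift I [:: a]) = \prod_j \prod_k
    (tan_weight j k ^+ (I j * I k) * tan_weight j k ^+ ((a == j) * I k) *
     (tan_weight j k ^+ ((a == k) * I j) * tan_weight j k ^+ ((a == j) * (a == k)))).
  apply: eq_bigr => j _; apply: eq_bigr => k _; rewrite -!exprD; congr (_ ^+ _).
  rewrite !ffunE /= !addn0.
  by move: (nat_of_bool _) (nat_of_bool _) (I j) (I k) => x y u v; lia.
under eq_bigr do rewrite !big_split /=.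
rewrite !big_split /= -mulrA; congr (_ * _).
rewrite /tan_step; under [in RHS]eq_bigr do rewrite exprMn.
rewrite big_split /=; congr (_ * _).
  rewrite (bigD1 a) //= eqxx [X in _ * X]big1 ?mulr1.
    by apply: eq_bigr => k _; rewrite mul1n.
  by move=> j /negPf ja; rewrite big1 // => k _; rewrite eq_sym ja.
rewrite [X in _ * X]big1 ?mulr1.
  apply: eq_bigr => j _; rewrite (bigD1 a) //= eqxx mul1n big1 ?mulr1 //.
  by move=> k /negPf ka; rewrite eq_sym ka.
move=> j _; rewrite big1 // => k _.
case: eqP => [<-|_] //; case: eqP => [<-|_] //.
by rewrite /tan_weight ltnn expr1n.
Qed.

Lemma tan_step_shift1 I a b :
  tan_step a (shift I [:: b]) = tan_step a I * (tan_weight a b * tan_weight b a).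
Proof.
rewrite /tan_step; under eq_bigr do rewrite ffunE exprD.
rewrite big_split /=; congr (_ * _).
rewrite (bigD1 b) //= eqxx big1 ?mulr1 ?addn0 ?expr1 //.
by move=> k /negPf kb; rewrite eq_sym kb.
Qed.

Lemma tan_solution_cube I (j k l : 'I_n) : (j < k)%N -> (k < l)%N ->
  cube_rel tan_solution I j k l.
Proof.
move=> jk kl; have jl := ltn_trans jk kl.
have W (a b : 'I_n) : (a < b)%N -> tan_weight a b * tan_weight b a = tan_diff a b /\
   tan_weight b a * tan_weight a b = tan_diff a b.
  by move=> ab; rewrite /tan_weight ab ltnNge (ltnW ab) mulr1 mul1r.
have [[[Wjk Wkj] [Wkl Wlk]] [Wjl Wlj]] := (W _ _ jk, W _ _ kl, W _ _ jl).
rewrite /cube_rel -[[:: j; k; l]]/([:: j] ++ ([:: k] ++ [:: l])).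
rewrite -[[:: j; l]]/([:: j] ++ [:: l]) -[[:: j; k]]/([:: j] ++ [:: k]).
rewrite -[[:: k; l]]/([:: k] ++ [:: l]) -!shift_cat.
rewrite !tan_solution_shift1 !tan_step_shift1 !Wkj !Wlk !Wlj.
(* The four products of the relation share all other factors. What remains is the addition formula
   tan(x + y) = tan x + tan y + tan x tan y tan(x + y). *)
have E : tan_diff j l * tan_diff j k * tan_diff k l =
    tan_diff j l - tan_diff j k - tan_diff k l.
  by rewrite /tan_diff; field; rewrite !tan_denom_neq0.
by ring: E.
Qed.

End ExplicitSolution.

(** * The four relations at the top of a 4-cube *)

Section FourCube.
Variable K : fieldType.
Variables x0 x1 x2 x3 x4 x12 x13 x14 x23 x24 x34 x123 x124 x134 x234 x1234 : K.
Hypothesis x0_neq0 : x0 != 0.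
Hypothesis e123 : x13 * x2 = x0 * x123 + x12 * x3 + x23 * x1.
Hypothesis e124 : x14 * x2 = x0 * x124 + x12 * x4 + x24 * x1.
Hypothesis e134 : x14 * x3 = x0 * x134 + x13 * x4 + x34 * x1.
Hypothesis e234 : x24 * x3 = x0 * x234 + x23 * x4 + x34 * x2.

(** The right-hand side is the Pfaffian of the skew-symmetric 4 by 4 matrix with the entries
    x_ij. *)
Let pf := x0 * x1234 = x12 * x34 - x13 * x24 + x14 * x23.

Let E123 : x0 * x123 = x13 * x2 - x12 * x3 - x23 * x1.
Proof. by rewrite e123; ring. Qed.
Let E124 : x0 * x124 = x14 * x2 - x12 * x4 - x24 * x1.
Proof. by rewrite e124; ring. Qed.
Let E134 : x0 * x134 = x14 * x3 - x13 * x4 - x34 * x1.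
Proof. by rewrite e134; ring. Qed.
Let E234 : x0 * x234 = x24 * x3 - x23 * x4 - x34 * x2.
Proof. by rewrite e234; ring. Qed.

(** After multiplication by [x0] the bottom relations eliminate the values on triples. The
    difference of the two sides is then a multiple of the Pfaffian identity, and the nonzero factors
    cancel. *)
Let pf_factor (lhs rhs y : K) : y != 0 ->
  x0 * (lhs - rhs) = - y * (x0 * x1234 - (x12 * x34 - x13 * x24 + x14 * x23)) ->
  lhs = rhs <-> pf.
Proof.
move=> y0 e; split=> [lr|p].
  apply/eqP; rewrite -subr_eq0; move/eqP: e.
  by rewrite lr subrr mulr0 eq_sym mulf_eq0 oppr_eq0 (negPf y0).
apply/eqP; rewrite -subr_eq0; move/eqP: e.
by rewrite p subrr mulr0 mulf_eq0 (negPf x0_neq0).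
Qed.

(* On the 4-cube each of the four cube relations at the top vertex is
   equivalent to x_0 x_1234 = x_12 x_34 - x_13 x_24 + x_14 x_23. *)
Lemma top123_pf : x4 != 0 ->
  x134 * x24 = x4 * x1234 + x124 * x34 + x234 * x14 <-> pf.
Proof.
move=> y0; apply: (pf_factor y0).
transitivity ((x0 * x134) * x24 - x4 * (x0 * x1234) - (x0 * x124) * x34 - (x0 * x234) * x14).
  by ring.
by rewrite E124 E134 E234; ring.
Qed.

Lemma top124_pf : x3 != 0 ->
  x134 * x23 = x3 * x1234 + x123 * x34 + x234 * x13 <-> pf.
Proof.
move=> y0; apply: (pf_factor y0).
transitivity ((x0 * x134) * x23 - x3 * (x0 * x1234) - (x0 * x123) * x34 - (x0 * x234) * x13).
  by ring.
by rewrite E123 E134 E234; ring.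
Qed.

Lemma top134_pf : x2 != 0 ->
  x124 * x23 = x2 * x1234 + x123 * x24 + x234 * x12 <-> pf.
Proof.
move=> y0; apply: (pf_factor y0).
transitivity ((x0 * x124) * x23 - x2 * (x0 * x1234) - (x0 * x123) * x24 - (x0 * x234) * x12).
  by ring.
by rewrite E123 E124 E234; ring.
Qed.

Lemma top234_pf : x1 != 0 ->
  x124 * x13 = x1 * x1234 + x123 * x14 + x134 * x12 <-> pf.
Proof.
move=> y0; apply: (pf_factor y0).
transitivity ((x0 * x124) * x13 - x1 * (x0 * x1234) - (x0 * x123) * x14 - (x0 * x134) * x12).
  by ring.
by rewrite E123 E124 E134; ring.
Qed.

End FourCube.

(** * The recursion implies every cube relation *)

Section Consistency.
Variables (n : nat) (K : fieldType) (a : 'I_n -> nat).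
Notation lattice := {ffun 'I_n -> nat}.
Variable f : lattice -> K.

Definition in_box (I : lattice) : Prop := forall i, (I i <= a i)%N.

Hypothesis f_neq0 : forall I, in_box I -> f I != 0.
Hypothesis f_rec : forall I p q r t, in_box I -> lsupp I = [:: p, q, r & t] ->
  cube_rel f (lower I [:: p; q; r]) p q r.

Lemma cube_rel_shift1 I (m j k l : 'I_n) :
  cube_rel f (shift I [:: m]) j k l <->
  f (shift I [:: m; j; l]) * f (shift I [:: m; k]) =
  f (shift I [:: m]) * f (shift I [:: m; j; k; l]) +
  f (shift I [:: m; j; k]) * f (shift I [:: m; l]) +
  f (shift I [:: m; k; l]) * f (shift I [:: m; j]).
Proof. by rewrite /cube_rel !shift_cat. Qed.

(** All four conclusions involve the top vertex and are equivalent to the same Pfaffian identity.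
    The three implications listed are those that replace one index of a triple at a time. *)
Lemma four_cube I (i1 i2 i3 i4 : 'I_n) :
  in_box (shift I [:: i1; i2; i3; i4]) ->
  [/\ cube_rel f I i1 i2 i3, cube_rel f I i1 i2 i4, cube_rel f I i1 i3 i4
    & cube_rel f I i2 i3 i4] ->
  [/\ cube_rel f (shift I [:: i4]) i1 i2 i3 -> cube_rel f (shift I [:: i3]) i1 i2 i4,
      cube_rel f (shift I [:: i3]) i1 i2 i4 -> cube_rel f (shift I [:: i2]) i1 i3 i4 &
      cube_rel f (shift I [:: i2]) i1 i3 i4 -> cube_rel f (shift I [:: i1]) i2 i3 i4].
Proof.
move=> bx [e123 e124 e134 e234].
have nz s : (forall i, (count_mem i s <= count_mem i [:: i1; i2; i3; i4])%N) ->
    f (shift I s) != 0.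
  move=> sc; apply: f_neq0 => i; apply: leq_trans (bx i).
  by rewrite !ffunE leq_add2l.
have n0 : f I != 0 by rewrite -[I]shift0; apply: nz.
have n1 : f (shift I [:: i1]) != 0 by apply: nz => i /=; case: (i1 == i) (i2 == i) (i3 == i) (i4 == i) => -[] [] [] //.
have n2 : f (shift I [:: i2]) != 0 by apply: nz => i /=; case: (i1 == i) (i2 == i) (i3 == i) (i4 == i) => -[] [] [] //.
have n3 : f (shift I [:: i3]) != 0 by apply: nz => i /=; case: (i1 == i) (i2 == i) (i3 == i) (i4 == i) => -[] [] [] //.
have n4 : f (shift I [:: i4]) != 0 by apply: nz => i /=; case: (i1 == i) (i2 == i) (i3 == i) (i4 == i) => -[] [] [] //.
have t1 := top123_pf (f (shift I [:: i1; i2; i3; i4])) n0 e124 e134 e234 n4.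
have t2 := top124_pf (f (shift I [:: i1; i2; i3; i4])) n0 e123 e134 e234 n3.
have t3 := top134_pf (f (shift I [:: i1; i2; i3; i4])) n0 e123 e124 e234 n2.
have t4 := top234_pf (f (shift I [:: i1; i2; i3; i4])) n0 e123 e124 e134 n1.
have P s t : (forall i, count_mem i s = count_mem i t) -> f (shift I s) = f (shift I t).
  by move=> st; congr f; apply/ffunP=> i; rewrite !ffunE st.
have E : [/\ cube_rel f (shift I [:: i4]) i1 i2 i3 <->
   f (shift I [:: i1; i3; i4]) * f (shift I [:: i2; i4]) =
   f (shift I [:: i4]) * f (shift I [:: i1; i2; i3; i4]) +
   f (shift I [:: i1; i2; i4]) * f (shift I [:: i3; i4]) +
   f (shift I [:: i2; i3; i4]) * f (shift I [:: i1; i4]),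
  cube_rel f (shift I [:: i3]) i1 i2 i4 <->
   f (shift I [:: i1; i3; i4]) * f (shift I [:: i2; i3]) =
   f (shift I [:: i3]) * f (shift I [:: i1; i2; i3; i4]) +
   f (shift I [:: i1; i2; i3]) * f (shift I [:: i3; i4]) +
   f (shift I [:: i2; i3; i4]) * f (shift I [:: i1; i3]),
  cube_rel f (shift I [:: i2]) i1 i3 i4 <->
   f (shift I [:: i1; i2; i4]) * f (shift I [:: i2; i3]) =
   f (shift I [:: i2]) * f (shift I [:: i1; i2; i3; i4]) +
   f (shift I [:: i1; i2; i3]) * f (shift I [:: i2; i4]) +
   f (shift I [:: i2; i3; i4]) * f (shift I [:: i1; i2]) &
  cube_rel f (shift I [:: i1]) i2 i3 i4 <->
   f (shift I [:: i1; i2; i4]) * f (shift I [:: i1; i3]) =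
   f (shift I [:: i1]) * f (shift I [:: i1; i2; i3; i4]) +
   f (shift I [:: i1; i2; i3]) * f (shift I [:: i1; i4]) +
   f (shift I [:: i1; i3; i4]) * f (shift I [:: i1; i2])].
  split; rewrite cube_rel_shift1.
  - rewrite (P [:: i4; i1; i3] [:: i1; i3; i4]) ?(P [:: i4; i2] [:: i2; i4])
      ?(P [:: i4; i1; i2; i3] [:: i1; i2; i3; i4]) ?(P [:: i4; i1; i2] [:: i1; i2; i4])
      ?(P [:: i4; i3] [:: i3; i4]) ?(P [:: i4; i2; i3] [:: i2; i3; i4])
      ?(P [:: i4; i1] [:: i1; i4]) // => i /=; case: (i1 == i) (i2 == i) (i3 == i) (i4 == i) => -[] [] [] //.
  - rewrite (P [:: i3; i1; i4] [:: i1; i3; i4]) ?(P [:: i3; i2] [:: i2; i3])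
      ?(P [:: i3; i1; i2; i4] [:: i1; i2; i3; i4]) ?(P [:: i3; i1; i2] [:: i1; i2; i3])
      ?(P [:: i3; i2; i4] [:: i2; i3; i4])
      ?(P [:: i3; i1] [:: i1; i3]) // => i /=; case: (i1 == i) (i2 == i) (i3 == i) (i4 == i) => -[] [] [] //.
  - rewrite (P [:: i2; i1; i4] [:: i1; i2; i4])
      ?(P [:: i2; i1; i3; i4] [:: i1; i2; i3; i4]) ?(P [:: i2; i1; i3] [:: i1; i2; i3])
      ?(P [:: i2; i1] [:: i1; i2]) // => i /=; case: (i1 == i) (i2 == i) (i3 == i) (i4 == i) => -[] [] [] //.
  - by [].
case: E => E1 E2 E3 E4; split=> h.
- by apply/E2; apply/t2; apply/t1; apply/E1.
- by apply/E3; apply/t3; apply/t2; apply/E2.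
- by apply/E4; apply/t4; apply/t3; apply/E3.
Qed.

(** Induction on the weight of the top vertex. The recursion gives only the relation for the first
    three indices p, q, r of the support. Passing through 4-cubes with the same top vertex, r is
    replaced by l, then q by k, then p by j. *)
Lemma consistency_lower J (j k l : 'I_n) : in_box J -> (j < k)%N -> (k < l)%N ->
  (0 < J j)%N -> (0 < J k)%N -> (0 < J l)%N -> cube_rel f (lower J [:: j; k; l]) j k l.
Proof.
move: {2}(weight J) (leqnn (weight J)) => w.
elim: w J j k l => [|w IH] J j k l Jw bJ jk kl Jj Jk Jl.
  by move: Jw; rewrite leqn0 sum_nat_eq0 => /forallP/(_ j) /= /eqP J0; rewrite J0 in Jj.
have step (i1 i2 i3 i4 : 'I_n) : (i1 < i2)%N -> (i2 < i3)%N -> (i3 < i4)%N ->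
    (0 < J i1)%N -> (0 < J i2)%N -> (0 < J i3)%N -> (0 < J i4)%N ->
  [/\ cube_rel f (lower J [:: i1; i2; i3]) i1 i2 i3 -> cube_rel f (lower J [:: i1; i2; i4]) i1 i2 i4,
      cube_rel f (lower J [:: i1; i2; i4]) i1 i2 i4 -> cube_rel f (lower J [:: i1; i3; i4]) i1 i3 i4 &
      cube_rel f (lower J [:: i1; i3; i4]) i1 i3 i4 -> cube_rel f (lower J [:: i2; i3; i4]) i2 i3 i4].
  move=> l12 l23 l34 J1 J2 J3 J4.
  pose I := lower J [:: i1; i2; i3; i4].
  have cJ i : (count_mem i [:: i1; i2; i3; i4] <= J i)%N.
    by apply: uniq_count_le; [rewrite /= !inE -!val_eqE /=; lia |
       move=> i'; rewrite !inE => /or4P[] /eqP ->].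
  have IJ : shift I [:: i1; i2; i3; i4] = J by rewrite lowerK.
  have low s t : (forall i, count_mem i s + count_mem i t =
       count_mem i [:: i1; i2; i3; i4])%N -> lower J s = shift I t.
    move=> st; apply/ffunP=> i; rewrite !ffunE.
    move: (cJ i); rewrite -st.
    by move: (count_mem i s) (count_mem i t) (J i) => x' y' z'; lia.
  rewrite (low [:: i1; i2; i3] [:: i4]) ?(low [:: i1; i2; i4] [:: i3])
    ?(low [:: i1; i3; i4] [:: i2]) ?(low [:: i2; i3; i4] [:: i1]); 
    try by move=> i /=; case: (i1 == i) (i2 == i) (i3 == i) (i4 == i) => -[] [] [].
  apply: four_cube; first by rewrite IJ.
  (* The top vertex of a bottom relation is [J] with one unit of [m] removed, hence lighter, and the
     induction hypothesis applies. *)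
  have base (u v y : 'I_n) m : (u < v)%N -> (v < y)%N ->
     (forall i, count_mem i [:: u; v; y] + (m == i) = count_mem i [:: i1; i2; i3; i4])%N ->
     cube_rel f I u v y.
    move=> uv vy ct.
    have -> : I = lower (shift I [:: u; v; y]) [:: u; v; y].
      by apply/ffunP=> i; rewrite !ffunE addnK.
    have sJ : shift (shift I [:: u; v; y]) [:: m] = J.
      rewrite shift_cat -[RHS]IJ; apply/ffunP=> i.
      rewrite ffunE [RHS]ffunE -ct count_cat; congr (_ + (_ + _))%N.
      by rewrite /= addn0.
    apply: IH => //.
    - by have := weight_shift (shift I [:: u; v; y]) [:: m]; rewrite sJ /=; lia.
    - by move=> i; apply: leq_trans (bJ i); rewrite -sJ [X in (_ <= X)%N]ffunE leq_addr.
    - by rewrite ffunE /= eqxx; lia.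
    - by rewrite ffunE /= eqxx; lia.
    - by rewrite ffunE /= eqxx; lia.
  split.
  - by apply: (base _ _ _ i4) => // i /=; lia.
  - by apply: (base _ _ _ i3) => // [|i /=]; lia.
  - by apply: (base _ _ _ i2) => // [|i /=]; lia.
  - by apply: (base _ _ _ i1) => // i /=; lia.
have := sorted_lsupp J; have := mem_lsupp J.
case E : (lsupp J) => [|p [|q [|r t]]] memJ.
- by move: (memJ j); rewrite Jj.
- by move: (memJ j) (memJ k); rewrite Jj Jk !inE => /eqP ej /eqP ek; rewrite ej ek ltnn in jk.
- move: (memJ j) (memJ k) (memJ l); rewrite Jj Jk Jl !inE => + + + _.
  by move=> /orP[]/eqP ? /orP[]/eqP ? /orP[]/eqP ?; subst; lia.
have trans : transitive (fun i j : 'I_n => (i < j)%N) by move=> b c d; apply: ltn_trans.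
rewrite sorted_pairwise //= => /and4P[/and3P[pq pr pt] /andP[qr qt] rt _].
have [Jp Jq Jr] : [/\ 0 < J p, 0 < J q & 0 < J r]%N.
  by rewrite -!memJ !inE !eqxx !orbT.
(* Being the three smallest indices of the support, p, q, r are bounded termwise by j, k, l. *)
have pj : (p <= j)%N.
  have := memJ j; rewrite Jj !inE => /or4P[/eqP->|/eqP->|/eqP->|/(allP pt)] //; exact: ltnW.
have qk : (q <= k)%N.
  have := memJ k; rewrite Jk !inE => /or4P[/eqP e|/eqP->|/eqP->|/(allP qt)] //; try exact: ltnW.
  by move: jk; rewrite e ltnNge pj.
have rl : (r <= l)%N.
  have := memJ l; rewrite Jl !inE => /or4P[/eqP e|/eqP e|/eqP->|/(allP rt)] //; try exact: ltnW.
    by move: kl; rewrite e => kp; have := leq_trans qk (ltnW kp); rewrite leqNgt pq.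
  by move: kl; rewrite e ltnNge qk.
have c1 : cube_rel f (lower J [:: p; q; r]) p q r by apply: f_rec E.
have c2 : cube_rel f (lower J [:: p; q; l]) p q l.
  move: rl; rewrite leq_eqVlt => /orP[/eqP/val_inj <- //|rl].
  by have [h _ _] := step p q r l pq qr rl Jp Jq Jr Jl; apply: h.
have c3 : cube_rel f (lower J [:: p; k; l]) p k l.
  move: qk; rewrite leq_eqVlt => /orP[/eqP/val_inj <- //|qk].
  by have [_ h _] := step p q k l pq qk kl Jp Jq Jk Jl; apply: h.
move: pj; rewrite leq_eqVlt => /orP[/eqP/val_inj <- //|pj].
by have [_ _ h] := step p j k l pj jk kl Jp Jj Jk Jl; apply: h.
Qed.

Lemma consistency I (j k l : 'I_n) : (j < k)%N -> (k < l)%N ->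
  in_box (shift I [:: j; k; l]) -> cube_rel f I j k l.
Proof.
move=> jk kl bx.
have -> : I = lower (shift I [:: j; k; l]) [:: j; k; l].
  by apply/ffunP=> i; rewrite !ffunE addnK.
by apply: consistency_lower => //; rewrite ffunE /= eqxx; lia.
Qed.

End Consistency.

(** * Nonvanishing of polynomials and one-parameter rational families *)

Section GenericPoints.
Variable K : numFieldType.

Lemma poly_nonroot (q : {poly K}) : q != 0 -> exists s, q.[s] != 0.
Proof.
move=> q0; pose rs : seq K := [seq k%:R | k <- iota 0 (size q)].
have urs : uniq rs by rewrite map_inj_uniq ?iota_uniq // => i j /eqP; rewrite eqr_nat => /eqP.
have [ars|] := boolP (all (root q) rs); last by case/allPn=> s _ sq; exists s.
by have := max_poly_roots q0 ars urs; rewrite size_map size_iota ltnn.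
Qed.

Lemma horner_mmap r (F : 'I_r -> {poly K}) (p : mpoly r K) s :
  (mmap polyC F p).[s] = meval (fun i => (F i).[s]) p.
Proof.
rewrite mevalE /mmap horner_sum; apply: eq_bigr => m _.
rewrite hornerM hornerC /mmap1 horner_prod; congr (_ * _).
by apply: eq_bigr => i _; rewrite horner_exp.
Qed.

Lemma digits_inj (D r : nat) (f g : nat -> nat) :
  (forall i, (i < r)%N -> (f i < D)%N) -> (forall i, (i < r)%N -> (g i < D)%N) ->
  (\sum_(i < r) f i * D ^ i = \sum_(i < r) g i * D ^ i)%N ->
  forall i, (i < r)%N -> f i = g i.
Proof.
elim: r f g => [|r IH] f g fD gD //.
have E (h : nat -> nat) : (\sum_(i < r.+1) h i * D ^ i = D * (\sum_(i < r) h i.+1 * D ^ i) + h 0)%N.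
  rewrite big_ord_recl expn0 muln1 addnC; congr addn.
  by rewrite big_distrr /=; apply: eq_bigr => i _; rewrite /bump add1n expnS mulnCA.
rewrite !E => e; have D0 : (0 < D)%N by apply: leq_ltn_trans (fD 0%N isT).
have e0 : f 0%N = g 0%N.
  by move/(congr1 (modn^~ D)): e; rewrite ![(D * _)%N]mulnC !modnMDl !modn_small ?fD ?gD.
move: e; rewrite e0 => /addIn/eqP; rewrite eqn_pmul2l // => /eqP e.
case=> [//|i] ir; apply: (IH (fun i => f i.+1) (fun i => g i.+1)) => // j jr.
  exact: fD.
exact: gD.
Qed.

(* Kronecker substitution X_i -> X^(D^i). *)
Lemma mpoly_nonroot r (p : mpoly r K) : p != 0 -> exists v, meval v p != 0.
Proof.
move=> p0; pose D := msize p.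
pose q := mmap polyC (fun i : 'I_r => 'X^(D ^ i)) p.
suff /poly_nonroot[s sq] : q != 0.
  by move: sq; rewrite horner_mmap => sq; eexists; exact: sq.
have [m mp] : exists m, m \in msupp p.
  case E: (msupp p) => [|m t]; last by exists m; rewrite inE eqxx.
  by move/eqP: E; rewrite msupp_eq0 (negPf p0).
pose k (m : multinom r) := (\sum_(i < r) m i * D ^ i)%N.
have qE : q = \sum_(m <- msupp p) mcoeff m p *: 'X^(k m).
  rewrite /q /mmap; apply: eq_bigr => m' _; rewrite mul_polyC /mmap1; congr (_ *: _).
  rewrite /k -prodrXr; apply: eq_bigr => i _.
  by rewrite -exprM mulnC.
have kinj m' : m' \in msupp p -> k m' = k m -> m' = m.
  move=> m'p kk; apply/mnmP => i.
  have md (m1 : multinom r) : m1 \in msupp p -> forall j, (m1 j < D)%N.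
    move=> m1p j; apply: leq_ltn_trans (msize_mdeg_lt m1p).
    by rewrite mdegE (bigD1 j) //= leq_addr.
  pose ext (m1 : multinom r) j := if insub j is Some j' then m1 j' else 0%N.
  have extE m1 (j : 'I_r) : ext m1 j = m1 j by rewrite /ext valK.
  have extD m1 : m1 \in msupp p -> forall j, (j < r)%N -> (ext m1 j < D)%N.
    by move=> m1p j jr; rewrite -[j]/(nat_of_ord (Ordinal jr)) extE md.
  have := @digits_inj D r (ext m') (ext m) (extD _ m'p) (extD _ mp).
  under eq_bigr do rewrite extE; under [X in _ = X]eq_bigr do rewrite extE.
  by move=> /(_ kk i (ltn_ord i)); rewrite !extE.
apply/eqP => /(congr1 (fun t : {poly K} => t`_(k m))).
rewrite qE coef_sum coef0 (bigD1_seq m) ?msupp_uniq //= coefZ coefXn eqxx mulr1.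
rewrite big_seq_cond big1 ?addr0 => [/eqP|m' /andP[m'p m'm]].
  by apply/negP; rewrite -mcoeff_msupp.
rewrite coefZ coefXn; case: eqP => [/esym/(kinj _ m'p) e|_]; last by rewrite mulr0.
by rewrite e eqxx in m'm.
Qed.

(** A rational function of the parameter without pole at 0 and with value [y] there. Agreement is
    asked only where the denominator is nonzero, so the convention x / 0 = 0 inside [g] does no
    harm. *)
Definition regular (g : K -> K) (y : K) : Prop :=
  exists N D : {poly K}, [/\ D.[0] != 0, N.[0] = y * D.[0] &
    forall s, D.[s] != 0 -> g s = N.[s] / D.[s]].

Lemma regularB g h y z : regular g y -> regular h z ->
  regular (fun s => g s - h s) (y - z).
Proof.
move=> [N [D [D0 N0 gE]]] [N' [D' [D'0 N'0 hE]]].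
exists (N * D' - N' * D), (D * D'); split.
- by rewrite hornerM mulf_neq0.
- by rewrite hornerD hornerN !hornerM N0 N'0; ring.
move=> s; rewrite hornerM mulf_eq0 negb_or => /andP[Ds D's].
rewrite gE // hE // hornerD hornerN !hornerM.
by field; rewrite Ds D's.
Qed.

Lemma regularM g h y z : regular g y -> regular h z ->
  regular (fun s => g s * h s) (y * z).
Proof.
move=> [N [D [D0 N0 gE]]] [N' [D' [D'0 N'0 hE]]].
exists (N * N'), (D * D'); split.
- by rewrite hornerM mulf_neq0.
- by rewrite !hornerM N0 N'0; ring.
move=> s; rewrite hornerM mulf_eq0 negb_or => /andP[Ds D's].
by rewrite gE // hE // !hornerM; field; rewrite Ds D's.
Qed.

Lemma regularV h z : z != 0 -> regular h z -> regular (fun s => (h s)^-1) z^-1.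
Proof.
move=> z0 [N [D [D0 N0 hE]]].
exists (D * D), (N * D); split.
- by rewrite hornerM N0 !mulf_neq0.
- by rewrite !hornerM N0; field.
move=> s; rewrite hornerM mulf_eq0 negb_or => /andP[Ns Ds].
by rewrite hE // !hornerM; field; rewrite Ds Ns.
Qed.

Lemma regular_line x d : regular (fun s => x + s * d) x.
Proof.
exists (x%:P + d *: 'X), 1; split.
- by rewrite hornerC oner_eq0.
- by rewrite hornerD hornerZ hornerX !hornerC mulr0 mulr1 addr0.
- by move=> s _; rewrite hornerD hornerZ hornerX !hornerC divr1 mulrC.
Qed.

End GenericPoints.

(** * Solving the cube relations from data on supports of size at most two *)

Section Recursion.
Variables (n : nat) (K : fieldType).
Notation lattice := {ffun 'I_n -> nat}.

(** The argument [m] is fuel, since the recursion descends by weight. Once the fuel is at least the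
    weight, the value is independent of it and [d] is read only at points with at most two nonzero
    coordinates. *)
Fixpoint cube_rec (d : lattice -> K) (m : nat) (I : lattice) : K :=
  if m isn't m'.+1 then d I else
  if lsupp I is [:: p, q, r & _] then
    let f s := cube_rec d m' (shift (lower I [:: p; q; r]) s) in
    (f [:: p; r] * f [:: q] - f [:: p; q] * f [:: r] - f [:: q; r] * f [:: p]) / f [::]
  else d I.

Lemma lsupp3P (I : lattice) p q r t : lsupp I = [:: p, q, r & t] ->
  [/\ (p < q)%N, (q < r)%N & shift (lower I [:: p; q; r]) [:: p; q; r] = I].
Proof.
move=> E; have := sorted_lsupp I; rewrite E /= => /and3P[pq qr _]; split=> //.
apply: lowerK; apply: uniq_count_le.
  by rewrite /= !inE -!val_eqE /=; lia.
by move=> i ip; rewrite -mem_lsupp E; move: ip; rewrite !inE => /or3P[]->; rewrite ?orbT.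
Qed.

Lemma weight_lower3 (I : lattice) p q r t s : lsupp I = [:: p, q, r & t] ->
  (size s < 3)%N -> (weight (shift (lower I [:: p; q; r]) s) < weight I)%N.
Proof.
move=> /lsupp3P[_ _ E] s3; rewrite -[in X in (_ < X)%N]E !weight_shift.
by rewrite ltn_add2l.
Qed.

Lemma weight_eq0 (I : lattice) : weight I = 0%N -> lsupp I = [::].
Proof.
move/eqP; rewrite sum_nat_eq0 => /forallP I0.
by apply/nilP; rewrite /nilp size_filter -leqn0 leqNgt -has_count;
  apply/hasPn => i _; rewrite -eqn0Ngt; exact: I0.
Qed.

Lemma cube_rec_fuel d m m' (I : lattice) : (weight I <= m)%N -> (weight I <= m')%N ->
  cube_rec d m I = cube_rec d m' I.
Proof.
elim: m m' I => [|m IH] [|m'] I //=.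
- by rewrite leqn0 => /eqP/weight_eq0 ->.
- by move=> _; rewrite leqn0 => /eqP/weight_eq0 ->.
case E : (lsupp I) => [|p [|q [|r t]]] // Im Im'.
have W s : (size s < 3)%N -> cube_rec d m (shift (lower I [:: p; q; r]) s) =
    cube_rec d m' (shift (lower I [:: p; q; r]) s).
  by move=> /(weight_lower3 E) Is; apply: IH; rewrite -ltnS; apply: leq_trans Is _.
by rewrite !W.
Qed.

Definition cube_solution (d : lattice -> K) (I : lattice) : K := cube_rec d (weight I) I.

Lemma cube_solution_data d (I : lattice) : (size (lsupp I) <= 2)%N -> cube_solution d I = d I.
Proof.
rewrite /cube_solution; case: (weight I) => //= m.
by case: (lsupp I) => [|p [|q [|r t]]].
Qed.

Lemma cube_solutionE d (I : lattice) p q r t : lsupp I = [:: p, q, r & t] ->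
  let f s := cube_solution d (shift (lower I [:: p; q; r]) s) in
  cube_solution d I =
  (f [:: p; r] * f [:: q] - f [:: p; q] * f [:: r] - f [:: q; r] * f [:: p]) / f [::].
Proof.
move=> E f; rewrite /cube_solution.
have Is := weight_lower3 E; case W : (weight I) Is => [|m] Is.
  by have := weight_eq0 W; rewrite E.
have fE s : (size s < 3)%N -> cube_rec d m (shift (lower I [:: p; q; r]) s) = f s.
  by move=> s3; apply: cube_rec_fuel => //; rewrite -ltnS Is.
by rewrite /= E !fE.
Qed.

End Recursion.

(** * Nowhere zero solutions with generic initial data *)

Section GenericSolution.
Variables (n : nat) (K : numFieldType) (a : 'I_n -> nat).
Notation lattice := {ffun 'I_n -> nat}.

(** The tangent solution obeys the same recursion and never vanishes, so every division is by a
    function that is nonzero at parameter 0. *)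
Lemma cube_solution_regular (d : K -> lattice -> K) :
  (forall I, regular (d^~ I) (tan_solution K I)) ->
  forall I, regular (fun s => cube_solution (d s) I) (tan_solution K I).
Proof.
move=> dr I; move: {2}(weight I) (leqnn (weight I)) => w.
elim: w I => [|w IH] I Iw.
  have [N [D [D0 N0 dE]]] := dr I; exists N, D; split=> // s Ds.
  rewrite cube_solution_data ?dE // weight_eq0 //.
  by apply/eqP; rewrite -leqn0.
case E : (lsupp I) => [|p [|q [|r t]]].
1-3: have [N [D [D0 N0 dE]]] := dr I; exists N, D; split=> // s Ds;
  by rewrite cube_solution_data ?E ?dE.
have [pq qr IE] := lsupp3P E; set I0 := lower I [:: p; q; r] in IE *.
have reg s : (size s < 3)%N ->
    regular (fun z => cube_solution (d z) (shift I0 s)) (tan_solution K (shift I0 s)).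
  by move=> s3; apply: IH; rewrite -ltnS; apply: leq_trans Iw; exact: weight_lower3 E s3.
have nz J : tan_solution K J != 0 by exact: tan_solution_neq0.
have val : tan_solution K I =
   (tan_solution K (shift I0 [:: p; r]) * tan_solution K (shift I0 [:: q])
    - tan_solution K (shift I0 [:: p; q]) * tan_solution K (shift I0 [:: r])
    - tan_solution K (shift I0 [:: q; r]) * tan_solution K (shift I0 [:: p])) *
   (tan_solution K (shift I0 [::]))^-1.
  rewrite (tan_solution_cube K I0 pq qr) IE shift0.
  by field; exact: nz.
have R : regular (fun z => cube_solution (d z) I) (tan_solution K I) <->
    regular (fun z => let f s := cube_solution (d z) (shift I0 s) in
  (f [:: p; r] * f [:: q] - f [:: p; q] * f [:: r] - f [:: q; r] * f [:: p]) / f [::])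
  (tan_solution K I).
  by split=> -[N [D [D0 N0 dE]]]; exists N, D; split=> // s Ds; rewrite -dE //= (cube_solutionE _ E).
apply/R; rewrite val /=.
apply: regularM; last by apply: regularV => //; exact: reg.
by apply: regularB; first apply: regularB; apply: regularM; apply: reg.
Qed.

(** The initial data move on the line from the tangent solution at s = 0 to a point [w] at s = 1
    where [p] does not vanish. Each value in the box is a rational function of s that is nonzero at
    0, and [p] restricts to a polynomial that is nonzero at 1, so only finitely many s have to be
    avoided. *)
Lemma generic_cube_solution r (V : 'I_r -> lattice) (p : mpoly r K) :
  injective V -> (forall i, (size (lsupp (V i)) <= 2)%N) -> p != 0 ->
  exists f : lattice -> K,
    [/\ forall I, in_box a I -> f I != 0,
        forall I (j k l : 'I_n), (j < k)%N -> (k < l)%N ->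
          in_box a (shift I [:: j; k; l]) -> cube_rel f I j k l &
        meval (fun i => f (V i)) p != 0].
Proof.
move=> Vinj V2 p0; have [w wp] := mpoly_nonroot p0.
pose e := @tan_solution n K.
(* The sum is empty off the points [V i] and has a single term on them, by injectivity: only the
   prescribed data move. *)
pose dl I := \sum_(i | V i == I) (w i - e (V i)).
pose d s I := e I + s * dl I.
have dlV i : dl (V i) = w i - e (V i).
  by rewrite /dl (big_pred1 i) // => j /=; rewrite (inj_eq Vinj).
have reg : forall I, exists ND : {poly K} * {poly K}, [/\ ND.2.[0] != 0,
    ND.1.[0] = e I * ND.2.[0] & forall s, ND.2.[s] != 0 ->
    cube_solution (d s) I = ND.1.[s] / ND.2.[s]].
  move=> I; have dr J : regular (d^~ J) (e J) by exact: regular_line.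
  by have [N [D H]] := cube_solution_regular dr I; exists (N, D).
have {reg}[ND NDP] := choice reg.
pose M := (\max_i a i)%N.
pose box : seq lattice :=
  map (fun g : {ffun 'I_n -> 'I_M.+1} => [ffun i => (g i : nat)]) (enum {: {ffun 'I_n -> 'I_M.+1}}).
have boxP I : in_box a I -> I \in box.
  move=> Ia; apply/mapP.
  have IM i : (I i < M.+1)%N by rewrite ltnS (leq_trans (Ia i)) // (leq_bigmax i).
  exists [ffun i => Ordinal (IM i)]; first by rewrite mem_enum.
  by apply/ffunP=> i; rewrite !ffunE.
pose h := mmap polyC (fun i => (e (V i))%:P + (w i - e (V i)) *: 'X) p.
have h0 : h != 0.
  apply/eqP => /(congr1 (fun t : {poly K} => t.[1])); rewrite horner_mmap horner0.
  apply/eqP; rewrite (@meval_eq _ _ _ w) // => i.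
  by rewrite hornerD hornerC hornerZ hornerX mulr1 addrC subrK.
(* The denominators are included because the values are known to equal the fractions only where
   these are nonzero. *)
pose Q := \prod_(I <- box) ((ND I).1 * (ND I).2) * h.
have Q0 : Q != 0.
  rewrite mulf_neq0 // prodf_seq_neq0; apply/allP => I _ /=.
  have [D0 N0 _] := NDP I.
  have nz q : q.[0] != 0 -> q != 0 :> {poly K}.
    by apply: contraNneq => ->; rewrite horner0.
  by rewrite mulf_neq0 ?nz // N0 mulf_neq0 // tan_solution_neq0.
have [s] := poly_nonroot Q0.
rewrite hornerM mulf_eq0 negb_or horner_prod prodf_seq_neq0 => /andP[/allP sbox sh].
have nz I : in_box a I -> cube_solution (d s) I != 0.
  move=> /boxP/sbox /=; rewrite hornerM mulf_eq0 negb_or => /andP[Ns Ds].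
  by have [_ _ ->] := NDP I; rewrite // mulf_neq0 // invr_eq0.
exists (cube_solution (d s)); split=> //.
  move=> I j k l jk kl bx; apply: consistency bx => // J p' q r' t bJ E.
  have [_ _ JE] := lsupp3P E.
  rewrite /cube_rel JE (cube_solutionE _ E) shift0.
  have := nz (lower J [:: p'; q; r']); move=> nzl; field; apply: nzl.
  by move=> i; apply: leq_trans (bJ i); rewrite ffunE leq_subr.
move: sh; rewrite horner_mmap; congr (_ != _); apply: meval_eq => i.
rewrite cube_solution_data // /d dlV hornerD hornerC hornerZ hornerX.
by rewrite mulrC.
Qed.

End GenericSolution.

(** * Monotone lattice paths as words, and exchanges of adjacent letters *)

Section Words.
Variables (n : nat) (a : 'I_n -> nat).
Notation lattice := {ffun 'I_n -> nat}.
Notation word := (seq 'I_n).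

Definition lat0 : lattice := [ffun=> 0%N].

Fixpoint vertices (I : lattice) (w : word) : seq lattice :=
  I :: if w is i :: w' then vertices (shift I [:: i]) w' else [::].

Fixpoint edges (I : lattice) (w : word) : seq (lattice * 'I_n) :=
  if w is i :: w' then (I, i) :: edges (shift I [:: i]) w' else [::].

(** With [asc] this is the number of adjacent swaps left before the word is descending, with [desc]
    the number left before it is ascending. *)
Fixpoint inversions (e : rel 'I_n) (w : word) : nat :=
  if w is i :: w' then (count (e i) w' + inversions e w')%N else 0%N.

Definition asc : rel 'I_n := fun i j => (i < j)%N.
Definition desc : rel 'I_n := fun i j => (j < i)%N.

Lemma shift2C (I : lattice) (i j : 'I_n) : shift (shift I [:: i]) [:: j] = shift (shift I [:: j]) [:: i].
Proof. by rewrite !shift_cat; apply: shift_perm; rewrite (perm_catC [:: i] [:: j]). Qed.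

Lemma shift_cons (I : lattice) i w : shift (shift I [:: i]) w = shift I (i :: w).
Proof. by rewrite shift_cat. Qed.

Lemma size_vertices I w : size (vertices I w) = (size w).+1.
Proof. by elim: w I => [|i w IH] I //=; rewrite IH. Qed.

Lemma mem_vertices_cat I u s v : (v \in vertices I (u ++ s)) =
  (v \in vertices I u) || (v \in vertices (shift I u) s).
Proof.
elim: u I => [|i u IH] I /=.
  by rewrite shift0 inE; case: s => [|? ?] /=; rewrite !inE ?orbF ?orbb ?orbA ?orbb.
by rewrite !inE IH shift_cons orbA.
Qed.

Lemma mem_last_vertices I w : shift I w \in vertices I w.
Proof.
elim: w I => [|i w IH] I /=; first by rewrite shift0 inE.
by rewrite inE -shift_cons IH orbT.
Qed.

Lemma mem_head_vertices I w : I \in vertices I w.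
Proof. by case: w => [|i w]; rewrite /= inE eqxx. Qed.

Lemma edges_cat I u s : edges I (u ++ s) = edges I u ++ edges (shift I u) s.
Proof. by elim: u I => [|i u IH] I /=; rewrite ?shift0 // IH shift_cons. Qed.

Lemma inversions_cat_perm e u s t : perm_eq s t ->
  (inversions e (u ++ s) + inversions e t = inversions e (u ++ t) + inversions e s)%N.
Proof.
move=> st; elim: u => [|i u IH] /=; first by rewrite addnC.
have /permP -> : perm_eq (u ++ s) (u ++ t) by rewrite perm_cat2l.
by rewrite -!addnA IH.
Qed.

Lemma perm_swap (u t : word) i j : perm_eq (u ++ i :: j :: t) (u ++ j :: i :: t).
Proof. by rewrite perm_cat2l -[i :: j :: t]/([:: i] ++ [:: j] ++ t) perm_catCA. Qed.

Lemma inversions_swap (e : rel 'I_n) u i j t : e i j -> ~~ e j i ->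
  inversions e (u ++ i :: j :: t) = (inversions e (u ++ j :: i :: t)).+1.
Proof.
move=> ij ji; have := inversions_cat_perm e u (perm_swap [::] t i j).
by rewrite /= ij (negPf ji); lia.
Qed.

Lemma not_sorted (e : rel 'I_n) (w : word) : ~~ sorted e w ->
  exists u x y t, w = u ++ x :: y :: t /\ ~~ e x y.
Proof.
elim: w => [|x [|y w] IH] //=; have [xy|xy _] := boolP (e x y).
  by move=> /IH[u [x' [y' [t [-> h]]]]]; exists (x :: u), x', y', t.
by exists [::], x, y, w.
Qed.

Lemma cat_two_cases (u1 u2 t1 t2 : word) i1 j1 i2 j2 :
  u1 ++ i1 :: j1 :: t1 = u2 ++ i2 :: j2 :: t2 ->
  [\/ [/\ u1 = u2, i1 = i2, j1 = j2 & t1 = t2],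
      exists v, u2 = u1 ++ i1 :: j1 :: v /\ t1 = v ++ i2 :: j2 :: t2,
      exists v, u1 = u2 ++ i2 :: j2 :: v /\ t2 = v ++ i1 :: j1 :: t1 |
      [/\ u2 = rcons u1 i1, j1 = i2 & t1 = j2 :: t2] \/
      [/\ u1 = rcons u2 i2, j2 = i1 & t2 = j1 :: t1]].
Proof.
elim: u1 u2 => [|x1 u1 IH] [|x2 u2] /=.
- by case=> -> -> ->; constructor 1.
- case=> <-; case: u2 => [|y u2] /= [-> ->].
    by constructor 4; left.
  by constructor 2; exists u2.
- case=> ->; case: u1 IH => [|y u1] IH /= [-> <-].
    by constructor 4; right.
  by constructor 3; exists u1.
case=> -> /IH[[-> -> -> ->]|[v [-> ->]]|[v [-> ->]]|[[-> -> ->]|[-> -> ->]]].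
- by constructor 1.
- by constructor 2; exists v.
- by constructor 3; exists v.
- by constructor 4; left.
- by constructor 4; right.
Qed.

Section Matsumoto.
Variable M : lattice -> Prop.

(** In the application [M] says that a coordinate is a fraction in the family under study, and this
    equivalence is what a single cube relation provides. *)
Hypothesis M_flip : forall I (j k l : 'I_n), (j < k)%N -> (k < l)%N ->
  in_box a (shift I [:: j; k; l]) ->
  M I -> M (shift I [:: j]) -> M (shift I [:: l]) -> M (shift I [:: j; k]) ->
  M (shift I [:: k; l]) -> M (shift I [:: j; k; l]) ->
  M (shift I [:: k]) <-> M (shift I [:: j; l]).

Definition known I w := forall v, v \in vertices I w -> M v.

Lemma known_cat I u s : known I (u ++ s) <-> known I u /\ known (shift I u) s.
Proof.
split=> [h|[h1 h2] v]; last by rewrite mem_vertices_cat => /orP[/h1|/h2].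
by split=> v vs; apply: h; rewrite mem_vertices_cat vs ?orbT.
Qed.

Lemma known_cons I i w : known I (i :: w) <-> M I /\ known (shift I [:: i]) w.
Proof.
split=> [h|[h1 h2] v]; last by rewrite /= inE => /orP[/eqP->|/h2].
by split=> [|v vs]; apply: h; rewrite /= inE ?eqxx ?vs ?orbT.
Qed.

Lemma known_head I w : known I w -> M I.
Proof. by apply; exact: mem_head_vertices. Qed.

(** A derivation exhibits one chain of swaps ending at a descending word. The point of [good_swap]
    is that any other first swap can then be completed to such a chain as well. *)
Inductive good : word -> Prop :=
| GoodMax w : known lat0 w -> sorted (fun i j : 'I_n => (j <= i)%N) w -> good w
| GoodStep u (i j : 'I_n) t : (i < j)%N -> known lat0 (u ++ i :: j :: t) ->
    good (u ++ j :: i :: t) -> good (u ++ i :: j :: t).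

Lemma good_known w : good w -> known lat0 w.
Proof. by case. Qed.

Lemma known_swap u i j t : known lat0 (u ++ i :: j :: t) ->
  M (shift (shift lat0 u) [:: j]) -> known lat0 (u ++ j :: i :: t).
Proof.
rewrite !known_cat !known_cons => -[ku [kI [_ kt]]] kj.
by split=> //; split=> //; split=> //; rewrite shift2C.
Qed.

(* Exchange argument of Matsumoto's theorem: commuting swaps are exchanged
   freely, and a braid i j k -> k j i is exactly one cube flip. *)
Lemma good_swap u (i j : 'I_n) t : (i < j)%N ->
  (forall x, (count_mem x (u ++ i :: j :: t) <= a x)%N) ->
  good (u ++ i :: j :: t) -> good (u ++ j :: i :: t).
Proof.
pose w := u ++ i :: j :: t.
move: {2}(inversions asc w) (leqnn (inversions asc w)) => N.
rewrite /w => {w}; elim: N u i j t => [|N IH] u i j t wN ij cw gw.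
  by move: wN; rewrite inversions_swap // /asc -leqNgt ltnW.
have desc_swap (u' t' : word) (x y : 'I_n) : (x < y)%N ->
    inversions asc (u' ++ x :: y :: t') = (inversions asc (u' ++ y :: x :: t')).+1.
  by move=> xy; apply: inversions_swap; rewrite /asc // -leqNgt ltnW.
have cperm w1 w2 : perm_eq w1 w2 -> (forall x, (count_mem x w1 <= a x)%N) ->
    forall x, (count_mem x w2 <= a x)%N.
  by move=> /permP e h x; rewrite -e.
case: {-1}_ / gw (erefl (u ++ i :: j :: t)) => [w _ sw wE|u1 i1 j1 t1 ij1 k1 g1 wE].
  move: sw; rewrite -wE => /(cat_sorted2 (s := u)) [_ /=].
  by rewrite leqNgt ij.
have kw : known lat0 (u ++ i :: j :: t) by rewrite wE.
case: (cat_two_cases wE).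
- by case=> -> -> -> ->.
- case=> v [uE tE]; subst u1 t.
  move: g1; rewrite -catA /= => g1.
  have g12 : good (u ++ j :: i :: v ++ j1 :: i1 :: t1).
    apply: IH => //.
      rewrite -ltnS; apply: leq_trans wN.
      have := desc_swap (u ++ i :: j :: v) t1 _ _ ij1; rewrite -!catA /= => ->.
      by [].
    apply: cperm cw; have := perm_swap (u ++ i :: j :: v) t1 i1 j1.
    by rewrite -!catA.
  rewrite -/([:: j, i & v] ++ i1 :: j1 :: t1) catA; apply: GoodStep => //.
    rewrite -catA /=; apply: known_swap kw _.
    by move: (good_known g12); rewrite !known_cat !known_cons => -[_ [_ []]].
  by rewrite -catA.
- case=> v [uE tE]; subst u t1.
  have g12 : good ((u1 ++ j1 :: i1 :: v) ++ j :: i :: t).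
    apply: IH => //.
    + rewrite -ltnS; apply: leq_trans wN.
      by rewrite -!catA /= (desc_swap u1 _ _ _ ij1).
    + apply: cperm cw; rewrite -!catA /=; exact: perm_swap.
    + by rewrite -catA.
  rewrite -catA /=; apply: GoodStep => //; last by move: g12; rewrite -catA.
  have -> : u1 ++ i1 :: j1 :: v ++ j :: i :: t = (u1 ++ i1 :: j1 :: v) ++ j :: i :: t.
    by rewrite -catA.
  apply: known_swap kw _.
  move: (good_known g12); rewrite known_cat known_cons => -[_ [_ /known_head]].
  have -> // : shift lat0 (u1 ++ j1 :: i1 :: v) = shift lat0 (u1 ++ i1 :: j1 :: v).
  by apply: shift_perm; rewrite perm_sym; exact: perm_swap.
have kwE u' x y z t' : known lat0 (u' ++ x :: y :: z :: t') ->
    let I := shift lat0 u' in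
    [/\ M I, M (shift I [:: x]), M (shift I [:: x; y]) & M (shift I [:: x; y; z])].
  rewrite known_cat !known_cons => -[_ [h1 [h2 [h3 /known_head h4]]]] I.
  by split=> //; [rewrite -shift_cons | rewrite -(shift_cons _ x) -(shift_cons _ y)].
have box3 u' x y z t' : (forall x', (count_mem x' (u' ++ x :: y :: z :: t') <= a x')%N) ->
    in_box a (shift (shift lat0 u') [:: x; y; z]).
  move=> h x'; apply: leq_trans (h x').
  by rewrite !ffunE add0n count_cat leq_add2l /= !leq_add2l.
case=> -[uE iE tE]; subst.
(* With k for [j1], the given chain starts with i j k -> i k j. Induction continues it by k i j and
   k j i, which makes [M] known on this side of the cube. The flip yields [M] at e_j, and j i k -> j
   k i -> k j i is the chain on the other side. *)
- rename i1 into j.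
  move: g1; rewrite cat_rcons => g1.
  have wN1 : (inversions asc (u ++ i :: j1 :: j :: t1) <= N)%N.
    by move: wN; rewrite -cat_rcons desc_swap // cat_rcons ltnS.
  have cw1 : forall x, (count_mem x (u ++ i :: j1 :: j :: t1) <= a x)%N.
    by apply: cperm cw; have := perm_swap (rcons u i) t1 j j1; rewrite !cat_rcons.
  have ij' := ltn_trans ij ij1.
  have g2 := IH _ _ _ _ wN1 ij' cw1 g1.
  have wN2 : (inversions asc (rcons u j1 ++ i :: j :: t1) <= N)%N.
    by rewrite cat_rcons; apply: leq_trans wN1; rewrite [X in (_ <= X)%N]desc_swap.
  have cw2 : forall x, (count_mem x (rcons u j1 ++ i :: j :: t1) <= a x)%N.
    by rewrite cat_rcons; apply: cperm cw1; exact: perm_swap.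
  have g3 : good (rcons u j1 ++ j :: i :: t1) by apply: IH => //; rewrite cat_rcons.
  rewrite cat_rcons in g3.
  have [m0 mi mij mijk] := kwE _ _ _ _ _ kw.
  have [_ _ mik _] := kwE _ _ _ _ _ (good_known g1).
  have [_ mk mkj _] := kwE _ _ _ _ _ (good_known g3).
  have mjk : M (shift (shift lat0 u) [:: j; j1]) by rewrite -shift_cons shift2C shift_cons.
  have mj : M (shift (shift lat0 u) [:: j]).
    by apply/(M_flip ij ij1); [exact: box3 cw|..].
  have kj := known_swap kw mj.
  have kjk : known lat0 (rcons u j ++ j1 :: i :: t1).
    apply: known_swap; first by rewrite cat_rcons.
    by rewrite -cats1 -shift_cat shift_cons.
  rewrite -cat_rcons; apply: GoodStep => //; first by rewrite cat_rcons.
  by rewrite cat_rcons; apply: GoodStep => //; rewrite -cat_rcons.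
rename i into j, j into k, i1 into i.
rewrite cat_rcons in kw cw wN; rewrite cat_rcons.
have wN1 : (inversions asc (rcons u1 j ++ i :: k :: t) <= N)%N.
  by move: wN; rewrite cat_rcons desc_swap // ltnS.
have cw1 : forall x, (count_mem x (rcons u1 j ++ i :: k :: t) <= a x)%N.
  by rewrite cat_rcons; apply: cperm cw; exact: perm_swap.
have ik := ltn_trans ij1 ij.
have g2 : good (rcons u1 j ++ k :: i :: t) by apply: IH => //; rewrite cat_rcons.
rewrite cat_rcons in g2.
have wN2 : (inversions asc (u1 ++ j :: k :: i :: t) <= N)%N.
  by rewrite -cat_rcons; apply: leq_trans wN1; rewrite [X in (_ <= X)%N]desc_swap.
have cw2 : forall x, (count_mem x (u1 ++ j :: k :: i :: t) <= a x)%N.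
  by rewrite -cat_rcons; apply: cperm cw1; exact: perm_swap.
have g3 : good (u1 ++ k :: j :: i :: t) by apply: IH.
have [m0 mi mij mijk] := kwE _ _ _ _ _ kw.
have [_ mj mjk _] := kwE _ _ _ _ _ (good_known g2).
have [_ mk _ _] := kwE _ _ _ _ _ (good_known g3).
have mik : M (shift (shift lat0 u1) [:: i; k]).
  by apply/(M_flip ij1 ij); [exact: box3 cw|..].
have kik : known lat0 (u1 ++ i :: k :: j :: t).
  rewrite -cat_rcons; apply: known_swap; first by rewrite cat_rcons.
  by rewrite -cats1 -shift_cat shift_cons.
apply: GoodStep => //; rewrite -cat_rcons; apply: GoodStep; rewrite ?cat_rcons //.
exact: known_swap kik mk.
Qed.

Lemma sorted_ord_eq (w w' : word) : perm_eq w w' ->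
  sorted (fun i j : 'I_n => (i <= j)%N) w -> sorted (fun i j : 'I_n => (i <= j)%N) w' -> w = w'.
Proof.
move=> ww' sw sw'; apply: (sorted_eq (leT := fun i j : 'I_n => (i <= j)%N)) ww' => //.
- by move=> x y z; apply: leq_trans.
- by move=> x y; rewrite -eqn_leq => /eqP/val_inj.
Qed.

(** Induction on the descents of [w']: undoing one descent gives a word nearer to [w], and
    [good_swap] carries goodness back. *)
Lemma good_perm w w' : sorted (fun i j : 'I_n => (i <= j)%N) w ->
  (forall x, (count_mem x w <= a x)%N) -> good w -> perm_eq w w' -> good w'.
Proof.
move=> sw cw gw; move: {2}(inversions desc w') (leqnn (inversions desc w')) => N.
elim: N w' => [|N IH] w' wN ww'; have [sw'|] := boolP (sorted (fun i j : 'I_n => (i <= j)%N) w');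
  try by rewrite -(sorted_ord_eq ww' sw sw').
all: move=> /not_sorted[u [j [i [t [wE]]]]]; rewrite -ltnNge => ij; subst w'.
all: have E : inversions desc (u ++ j :: i :: t) = (inversions desc (u ++ i :: j :: t)).+1
  by apply: inversions_swap; rewrite /desc // -leqNgt ltnW.
  by rewrite E in wN.
apply: good_swap => //.
  by move=> x; have /permP <- := perm_trans ww' (perm_swap u t j i).
apply: IH; first by rewrite E in wN.
exact: perm_trans ww' (perm_swap u t j i).
Qed.

End Matsumoto.

Definition word_of (I : lattice) : word := flatten [seq nseq (I i) i | i <- enum 'I_n].

Lemma count_word_of (I : lattice) i : count_mem i (word_of I) = I i.
Proof.
rewrite /word_of count_flatten -map_comp sumnE big_map big_enum /=.
rewrite (bigD1 i) //= count_nseq /= eqxx mul1n big1 ?addn0 //.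
by move=> j /negPf ji; rewrite count_nseq /= ji.
Qed.

Lemma mem_word_of (I : lattice) i : (i \in word_of I) = (0 < I i)%N.
Proof. by rewrite -has_pred1 has_count count_word_of. Qed.

Lemma sorted_word_of (I : lattice) : sorted (fun i j : 'I_n => (i <= j)%N) (word_of I).
Proof.
have tr : transitive (fun i j : 'I_n => (i <= j)%N) by move=> x y z; apply: leq_trans.
rewrite /word_of; have : sorted (fun i j : 'I_n => (i < j)%N) (enum 'I_n).
  by have := iota_ltn_sorted 0 n; rewrite -val_enum_ord sorted_map.
elim: (enum 'I_n) => [|i s IH] //= pis.
rewrite sorted_pairwise // pairwise_cat -!sorted_pairwise // IH ?(path_sorted pis) // andbT.
apply/andP; split; last by elim: (I i) => [|[|m]] //= ->; rewrite leqnn.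
apply/allrelP => x y; rewrite mem_nseq => /andP[_ /eqP ->] /flattenP[_ /mapP[j js ->]].
rewrite mem_nseq => /andP[_ /eqP ->]; apply: ltnW.
by move: pis; rewrite (path_sortedE _) => [/andP[/allP/(_ j js)]|x' y' z']; last exact: ltn_trans.
Qed.

Lemma shift_word_of (I : lattice) : shift lat0 (word_of I) = I.
Proof. by apply/ffunP=> i; rewrite !ffunE add0n count_word_of. Qed.

Definition top : lattice := [ffun i => a i].

(** Each point [I] of the box lies on a path that rearranges the top word: the word of [I] followed
    by the word of its complement. *)
Lemma good_all (M : lattice -> Prop) :
  (forall I (j k l : 'I_n), (j < k)%N -> (k < l)%N ->
  in_box a (shift I [:: j; k; l]) ->
  M I -> M (shift I [:: j]) -> M (shift I [:: l]) -> M (shift I [:: j; k]) ->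
  M (shift I [:: k; l]) -> M (shift I [:: j; k; l]) ->
  M (shift I [:: k]) <-> M (shift I [:: j; l])) ->
  good M (word_of top) -> forall I, in_box a I -> M I.
Proof.
move=> flip gt I Ia.
have : good M (word_of I ++ word_of [ffun i => (a i - I i)%N]).
  apply: (good_perm flip (sorted_word_of _) _ gt).
    by move=> x; rewrite count_word_of ffunE.
  by apply/allP => x _ /=; rewrite count_cat !count_word_of !ffunE subnKC ?Ia.
move/good_known/known_cat => -[h _]; apply: h.
by rewrite -{1}(shift_word_of I); exact: mem_last_vertices.
Qed.

End Words.

(** * Sweeping an abstract tiling from its right boundary to its left boundary *)

Section Sweeps.
Variables (n : nat) (a : 'I_n -> nat).
Notation lattice := {ffun 'I_n -> nat}.
Notation word := (seq 'I_n).

Variables (V : lattice -> Prop) (E : lattice -> 'I_n -> Prop)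
  (F : lattice -> 'I_n -> 'I_n -> Prop).

(* F I i k is meant for i < k; its right vertex is then I + e_i and its left
   vertex I + e_k, since the directions turn counterclockwise with the index. *)
Hypothesis F_box : forall I i k, F I i k -> in_box a (shift I [:: i; k]).
Hypothesis F_edges : forall I (i k : 'I_n), (i < k)%N -> F I i k ->
  [/\ E I i, E I k & E (shift I [:: k]) i].
Hypothesis E_vertices : forall I i, E I i -> V I /\ V (shift I [:: i]).
Hypothesis V_box : forall I, V I -> in_box a I.
(** The condition on [k] says that there is room to the left of the edge. The tile found there has
    the edge as its lower right side in the first case and as its upper right side in the second. *)
Hypothesis left_tile : forall I (i k : 'I_n), E I i ->
  ((i < k)%N && (I k < a k)%N) || ((k < i)%N && (0 < I k)%N) ->
  (exists2 k' : 'I_n, (i < k')%N & F I i k') \/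
  (exists I' (k' : 'I_n), [/\ (k' < i)%N, I = shift I' [:: k'] & F I' k' i]).
Hypothesis right_vertex_inj : forall I I' (i k i' k' : 'I_n), (i < k)%N -> (i' < k')%N ->
  F I i k -> F I' i' k' -> shift I [:: i] = shift I' [:: i'] ->
  [/\ I = I', i = i' & k = k'].
Hypothesis left_vertex_tile : forall v (i k : 'I_n), V v -> (i < k)%N ->
  (v i < a i)%N -> (0 < v k)%N ->
  exists I (i' k' : 'I_n), [/\ (i' < k')%N, F I i' k' & v = shift I [:: k']].
Hypothesis right_boundary : forall I (i : 'I_n), in_box a I -> (I i < a i)%N ->
  (forall k : 'I_n, (k < i)%N -> I k = a k) -> (forall k : 'I_n, (i < k)%N -> I k = 0%N) -> E I i.

Definition path_in (w : word) := forall c, c \in edges (lat0 n) w -> E c.1 c.2.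

Definition full (w : word) := forall i, count_mem i w = a i.

(** On the leftmost path the letters descend, so an index is used only after all larger ones are
    exhausted. *)
Definition left_boundary (v : lattice) :=
  forall k i : 'I_n, (k < i)%N -> (0 < v k)%N -> (v i < a i)%N -> False.

Let vtx (u : word) := shift (lat0 n) u.

Lemma path_in_edge u i t : path_in (u ++ i :: t) -> E (vtx u) i.
Proof.
by move=> h; apply: (h (vtx u, i)); rewrite edges_cat mem_cat inE eqxx orbT.
Qed.

Lemma tile_not_left_boundary I (i k : 'I_n) : (i < k)%N -> F I i k ->
  ~ left_boundary (shift I [:: i]).
Proof.
move=> ik f /(_ i k ik); apply; first by rewrite ffunE /= eqxx; lia.
have := F_box f k; rewrite !ffunE /= eqxx.
by have /negPf -> : i != k; [rewrite -val_eqE /=; lia | lia].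
Qed.

Lemma vtx_rcons u i : vtx (rcons u i) = shift (vtx u) [:: i].
Proof. by rewrite /vtx -cats1 shift_cat. Qed.

(** The edge [x] of the path is the lower right side of a tile. The next edge starts at the right
    vertex of this tile, which is off the left boundary, so it has a tile on its left too. If it is
    the lower right side of that tile, the argument moves on; if it is the upper right side, both
    tiles coincide, having the same right vertex, and the path follows both right sides. *)
Lemma forward_tile u (x k : 'I_n) t : full (u ++ x :: t) -> path_in (u ++ x :: t) ->
  (x < k)%N -> F (vtx u) x k ->
  exists u' (i j : 'I_n) t', [/\ (i < j)%N, u ++ x :: t = u' ++ i :: j :: t' & F (vtx u') i j].
Proof.
elim: t u x k => [|y t IH] u x k fw pw xk f.
  (* The path cannot end after [x]: the tile leaves room for a step [k], but a full word has used
     them all. *)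
  have /negPf xk' : x != k by rewrite -val_eqE /=; lia.
  have := F_box f k; rewrite !ffunE /= eqxx xk' !add0n -(fw k) count_cat /= xk' !addn0.
  by rewrite addn1 ltnn.
have ey : E (shift (vtx u) [:: x]) y.
  by rewrite -vtx_rcons; apply: (@path_in_edge _ _ t); rewrite cat_rcons.
have := tile_not_left_boundary xk f.
move=> /existsNP[k1 /existsNP[i1 /not_implyP[k1i1 /not_implyP[vk1 /not_implyP[vi1 _]]]]].
have [k2 h2] : exists k2 : 'I_n, ((y < k2)%N && (shift (vtx u) [:: x] k2 < a k2)%N) ||
    ((k2 < y)%N && (0 < shift (vtx u) [:: x] k2)%N).
  have [yi|iy] := ltnP y i1; first by exists i1; rewrite yi vi1.
  by exists k1; rewrite vk1 andbT (leq_trans k1i1 iy) orbT.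
have [[k' yk' f']|[I' [m [my vE f']]]] := left_tile ey h2.
  rewrite -vtx_rcons in f'.
  have [||u' [i [j [t' [ij wE f2]]]]] := IH (rcons u x) y k' _ _ yk' f'.
  - by rewrite cat_rcons.
  - by rewrite cat_rcons.
  by exists u', i, j, t'; rewrite -wE cat_rcons.
have [_ _ ky] := right_vertex_inj xk my f f' vE; subst k.
by exists u, x, y, t.
Qed.

Lemma first_left_boundary_exit (u : word) : ~ left_boundary (vtx u) ->
  exists u' x t, [/\ u = u' ++ x :: t, left_boundary (vtx u') & ~ left_boundary (vtx (rcons u' x))].
Proof.
elim/last_ind: u => [|u x IH].
  by case=> k i _; rewrite !ffunE.
move=> h; have [lb|/IH[u' [y [t [-> h1 h2]]]]] := pselect (left_boundary (vtx u)).
  by exists u, x, [::]; rewrite cats1.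
by exists u', y, (rcons t x); split=> //; rewrite rcons_cat.
Qed.

(** The first edge by which the path leaves the left boundary has a tile on its left. As this edge
    starts on the left boundary, it cannot be an upper right side, so [forward_tile] applies to
    it. *)
Lemma find_tile w : full w -> path_in w ->
  ~~ sorted (fun i j : 'I_n => (j <= i)%N) w ->
  exists u (i j : 'I_n) t, [/\ (i < j)%N, w = u ++ i :: j :: t & F (vtx u) i j].
Proof.
move=> fw pw /not_sorted[u [i [j [t [wE]]]]]; rewrite -ltnNge => ij.
have : ~ left_boundary (vtx (rcons u i)).
  move=> /(_ i j ij); apply.
    by rewrite !ffunE add0n -cats1 count_cat /= eqxx addn1.
  have /negPf ij' : i != j by rewrite -val_eqE /=; lia.
  by rewrite !ffunE add0n -cats1 count_cat -(fw j) wE count_cat /= eqxx ij' ltn_add2l.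
move=> /first_left_boundary_exit[u' [x [t' [uE lb nlb]]]].
have wE' : w = u' ++ x :: (t' ++ j :: t) by rewrite wE -cat_rcons uE -catA.
rewrite wE' in fw pw *.
have ex := path_in_edge pw.
move: nlb => /existsNP[k1 /existsNP[i1 /not_implyP[k1i1 /not_implyP[vk1 /not_implyP[vi1 _]]]]].
rewrite vtx_rcons in vk1 vi1.
have vxx : (vtx u' x < a x)%N.
  by rewrite -(fw x) ffunE ffunE add0n count_cat /= eqxx -{1}[count_mem x u']addn0 ltn_add2l.
have [k2 h2] : exists k2 : 'I_n, ((x < k2)%N && (vtx u' k2 < a k2)%N) ||
    ((k2 < x)%N && (0 < vtx u' k2)%N).
  have [xi|ix] := ltnP x i1.
    by exists i1; rewrite xi; move: vi1; rewrite ffunE; lia.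
  have k1x : (k1 < x)%N by exact: leq_trans k1i1 ix.
  exists k1; rewrite k1x /=; move: vk1; rewrite ffunE /=.
  have /negPf -> : x != k1 by rewrite -val_eqE /=; lia.
  by rewrite !addn0 => ->; rewrite orbT.
have [[k' xk' f']|[I' [m [mx vE f']]]] := left_tile ex h2.
  exact: forward_tile xk' f'.
case: (lb m x mx) => //.
by rewrite vE ffunE /= eqxx; lia.
Qed.

(** The list collects the right vertex of each tile as it is crossed and finally the vertices of the
    leftmost path, so its length depends on the word alone. *)
Inductive sweep : word -> seq lattice -> Prop :=
| SweepMax w : sorted (fun i j : 'I_n => (j <= i)%N) w -> sweep w (vertices (lat0 n) w)
| SweepStep u (i j : 'I_n) t L : (i < j)%N -> F (vtx u) i j ->
    sweep (u ++ j :: i :: t) L -> sweep (u ++ i :: j :: t) (vtx (rcons u i) :: L).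

Lemma path_in_vertices w v : V (lat0 n) -> path_in w -> v \in vertices (lat0 n) w -> V v.
Proof.
move=> V0; rewrite /path_in; move: (lat0 n) V0 => I.
elim: w I => [|i w IH] I VI pw /=.
  by rewrite inE => /eqP ->.
rewrite inE => /orP[/eqP -> //|].
apply: IH; last by move=> c cw; apply: pw; rewrite inE cw orbT.
by have [] := E_vertices (pw (I, i) (mem_head _ _)).
Qed.

Lemma sweep_exists w : full w -> path_in w -> V (lat0 n) ->
  exists L, sweep w L /\ forall v, v \in L -> V v.
Proof.
move=> + + V0; move: {2}(inversions (@asc n) w) (leqnn (inversions (@asc n) w)) => N.
elim: N w => [|N IH] w wN fw pw;
  have [sw|] := boolP (sorted (fun i j : 'I_n => (j <= i)%N) w);
  try by exists (vertices (lat0 n) w); split; [constructor | move=> v; exact: path_in_vertices].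
all: move=> /(find_tile fw pw)[u [i [j [t [ij wE f]]]]]; subst w.
all: have Ei : inversions (@asc n) (u ++ i :: j :: t) = (inversions (@asc n) (u ++ j :: i :: t)).+1
  by apply: inversions_swap; rewrite /asc // -leqNgt ltnW.
  by rewrite Ei in wN.
have [_ eij eji] := F_edges ij f.
have [|||L [sL VL]] := IH (u ++ j :: i :: t).
- by rewrite Ei in wN.
- by move=> x; rewrite -(fw x); apply/permP; rewrite perm_sym perm_swap.
- move=> c; rewrite edges_cat mem_cat /= !inE => /orP[cu|/or3P[/eqP ->|/eqP ->|ct]] //.
    by apply: pw; rewrite edges_cat mem_cat cu.
  by apply: pw; rewrite edges_cat mem_cat /= !inE shift2C ct !orbT.
exists (vtx (rcons u i) :: L); split; first exact: SweepStep.
move=> v; rewrite inE => /orP[/eqP->|/VL //].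
by have [_] := E_vertices (path_in_edge pw); rewrite vtx_rcons.
Qed.

Lemma sweep_size w L : sweep w L -> size L = (inversions (@asc n) w + (size w).+1)%N.
Proof.
elim=> [{}w sw|u i j t {}L ij f _ IH].
  rewrite size_vertices; suff -> : inversions (@asc n) w = 0%N by [].
  elim: w sw => [|x w IH] //= sw; rewrite IH ?(path_sorted sw) // addn0.
  apply/eqP; rewrite -leqn0 leqNgt -has_count; apply/hasPn => y yw; rewrite /asc -leqNgt.
  move: sw; rewrite path_sortedE; last by move=> p q r qp rq; exact: leq_trans rq qp.
  by case/andP=> /allP/(_ y yw).
have Ei : inversions (@asc n) (u ++ i :: j :: t) = (inversions (@asc n) (u ++ j :: i :: t)).+1.
  by apply: inversions_swap; rewrite /asc // -leqNgt ltnW.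
by rewrite /= IH Ei !size_cat.
Qed.

Lemma sweep_vertices w L : sweep w L ->
  forall v, v \in vertices (lat0 n) w -> v \in L.
Proof.
elim=> [//|u i j t {}L ij f _ IH] v.
rewrite mem_vertices_cat /= !inE -/(vtx u) -vtx_rcons => /orP[vu|/or3P[vI|-> //|vt]].
- by rewrite IH ?orbT // mem_vertices_cat vu.
- by rewrite IH ?orbT // mem_vertices_cat /= inE vI orbT.
move: vt; rewrite vtx_rcons shift2C => vt.
by rewrite IH ?orbT // mem_vertices_cat /= !inE vt !orbT.
Qed.

Lemma sweep_good (M : lattice -> Prop) w L : sweep w L -> (forall v, v \in L -> M v) ->
  good M w.
Proof.
elim=> [{}w sw|u i j t {}L ij f sL IH] ML; first exact: GoodMax.
have gm : good M (u ++ j :: i :: t) by apply: IH => v vL; apply: ML; rewrite inE vL orbT.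
apply: GoodStep => //; apply: known_swap (good_known gm) _.
by apply: ML; rewrite -/(vtx u) -vtx_rcons mem_head.
Qed.

Lemma sorted_desc_left_boundary w v : full w -> sorted (fun i j : 'I_n => (j <= i)%N) w ->
  v \in vertices (lat0 n) w -> left_boundary v.
Proof.
move=> fw sw vw.
have [u [t [wE ->]]] : exists u t, w = u ++ t /\ v = vtx u.
  rewrite /vtx; move: vw; move: (lat0 n) => I.
  elim: w I {fw sw} => [|x w IH] I /=.
    by rewrite inE => /eqP ->; exists [::], [::]; rewrite shift0.
  rewrite inE => /orP[/eqP ->|/IH[u [t [-> ->]]]]; first by exists [::], (x :: w); rewrite shift0.
  by exists (x :: u), t; rewrite shift_cons.
move=> k i ki; rewrite !ffunE !add0n -has_count -(fw i) wE count_cat.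
rewrite -[X in (X < _)%N]addn0 ltn_add2l -has_count !has_pred1 => ku it.
move: sw; rewrite wE sorted_pairwise; last by move=> p q r qp rq; exact: leq_trans rq qp.
rewrite pairwise_cat => /and3P[/allrelP/(_ k i ku it)].
by rewrite leqNgt ki.
Qed.

(** A vertex recorded on crossing a tile is its right vertex; the left vertex lies on the next path
    and is therefore in the list as well. *)
Lemma sweep_left_vertex w L : full w -> sweep w L -> forall v, v \in L ->
  left_boundary v \/ exists I (i k : 'I_n),
    [/\ (i < k)%N, F I i k, v = shift I [:: i] & shift I [:: k] \in L].
Proof.
move=> fw sL; elim: sL fw => [{}w sw|u i j t {}L ij f sL IH] fw v.
  by move=> vw; left; exact: sorted_desc_left_boundary vw.
rewrite inE => /orP[/eqP ->|vL]; last first.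
  have fw' : full (u ++ j :: i :: t).
    by move=> x; rewrite -(fw x); apply/permP; rewrite perm_sym perm_swap.
  case: (IH fw' v vL) => [|[I [i' [k' [h1 h2 h3 h4]]]]]; first by left.
  by right; exists I, i', k'; rewrite inE h4 orbT.
right; exists (vtx u), i, j; split=> //; first by rewrite vtx_rcons.
rewrite inE (sweep_vertices sL) ?orbT // mem_vertices_cat /= !inE.
by rewrite eqxx !orbT.
Qed.

Lemma full_top : full (word_of (top a)).
Proof. by move=> i; rewrite count_word_of ffunE. Qed.

Lemma path_in_top : path_in (word_of (top a)).
Proof.
have fw := full_top; have sw := sorted_word_of (top a).
move: (word_of (top a)) fw sw => w fw sw c cw.
have [u [t [wE ->]]] : exists u t, w = u ++ c.2 :: t /\ c.1 = vtx u.
  rewrite /vtx; move: cw; move: (lat0 n) => I.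
  elim: w I {fw sw} => [|x w IH] I //=.
  rewrite inE => /orP[/eqP ->|/IH[u [t [{1}-> ->]]]]; first by exists [::], w; rewrite shift0.
  by exists (x :: u), t; rewrite shift_cons.
move: c.2 wE => i wE {c cw}.
have tr : transitive (fun i j : 'I_n => (i <= j)%N) by move=> p q r; apply: leq_trans.
move: sw; rewrite wE sorted_pairwise // pairwise_cat /= => /and3P[/allrelP ui _ /andP[/allP it _]].
apply: right_boundary.
- by move=> x; rewrite !ffunE add0n -(fw x) wE count_cat leq_addr.
- by rewrite !ffunE add0n -(fw i) wE count_cat /= eqxx -[X in (X < _)%N]addn0 ltn_add2l.
- move=> k ki; rewrite !ffunE add0n -(fw k) wE count_cat -[LHS]addn0; congr addn.
  apply/esym/count_memPn; rewrite inE negb_or -val_eqE /= (ltn_eqF ki) /=.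
  by apply/negP => /it; rewrite leqNgt ki.
- move=> k ik; rewrite !ffunE add0n; apply/count_memPn/negP => ku.
  by have := ui k i ku (mem_head _ _); rewrite leqNgt ik.
Qed.

(** A measure that grows from right to left: in a tile with directions i < k, the right vertex I +
    e_i weighs less than the left vertex I + e_k. *)
Definition idx_weight (v : lattice) : nat := (\sum_(i < n) i * v i)%N.

Lemma idx_weight_shift1 I (i : 'I_n) : idx_weight (shift I [:: i]) = (idx_weight I + i)%N.
Proof.
rewrite /idx_weight; under eq_bigr do rewrite ffunE mulnDr.
rewrite big_split /=; congr addn.
rewrite (bigD1 i) //= eqxx big1 ?muln1 ?addn0 // => j /negPf ji.
by rewrite eq_sym ji muln0.
Qed.

Lemma right_boundary_vertex v : in_box a v ->
  ~ (exists i k : 'I_n, [/\ (i < k)%N, (v i < a i)%N & (0 < v k)%N]) ->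
  v \in vertices (lat0 n) (word_of (top a)).
Proof.
move=> bv nb.
have -> : word_of (top a) = word_of v ++ word_of [ffun i => (a i - v i)%N].
  apply: sorted_ord_eq.
  - by apply/allP => x _ /=; rewrite count_cat !count_word_of !ffunE subnKC // bv.
  - exact: sorted_word_of.
  have tr : transitive (fun i j : 'I_n => (i <= j)%N) by move=> p q r; apply: leq_trans.
  rewrite sorted_pairwise // pairwise_cat -!sorted_pairwise // !sorted_word_of !andbT.
  apply/allrelP => k i; rewrite !mem_word_of ffunE subn_gt0 => vk vi.
  by rewrite leqNgt; apply/negP => ik; apply: nb; exists i, k.
by rewrite mem_vertices_cat -{1}(shift_word_of v) mem_last_vertices.
Qed.

(* Every vertex off the right boundary is the left vertex of a tile whose
   right vertex is in L by induction; a tile being determined by its right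
   vertex, it is the one along which that vertex was swept. *)
Lemma sweep_all_vertices L : sweep (word_of (top a)) L -> forall v, V v -> v \in L.
Proof.
move=> sL v; move: {2}(idx_weight v) (erefl (idx_weight v)) => N.
elim/ltn_ind: N v => N IH v vN Vv.
have [[i [k [ik vi vk]]]|nb] :=
    pselect (exists i k : 'I_n, [/\ (i < k)%N, (v i < a i)%N & (0 < v k)%N]); last first.
  by apply: (sweep_vertices sL); apply: right_boundary_vertex => //; exact: V_box.
have [I [i' [k' [ik' f vE]]]] := left_vertex_tile Vv ik vi vk.
have [/E_vertices[_ Vr] _ _] := F_edges ik' f.
have := IH (idx_weight (shift I [:: i'])) _ _ erefl Vr.
rewrite -vN vE !idx_weight_shift1 ltn_add2l => /(_ ik') rL.
case: (sweep_left_vertex full_top sL rL) => [lb|[I2 [i2 [k2 [ik2 f2 vE2 lL]]]]].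
  by case: (tile_not_left_boundary ik' f).
by have [-> _ ->] := right_vertex_inj ik' ik2 f f2 vE2.
Qed.

Lemma count_sum_size (w : word) : (\sum_(i < n) count_mem i w = size w)%N.
Proof.
elim: w => [|x w IH] /=; first by rewrite big1.
rewrite big_split /= IH (bigD1 x) //= eqxx big1 ?add1n // => i /negPf.
by rewrite eq_sym => ->.
Qed.

Lemma inversions_le (w : word) : (inversions (@asc n) w <=
  \sum_(i < n) \sum_(j < n | i < j) count_mem i w * count_mem j w)%N.
Proof.
elim: w => [|x w IH] //=.
have -> : count (@asc n x) w = (\sum_(j < n | x < j) count_mem j w)%N.
  rewrite -sum1_count (partition_big id (fun j : 'I_n => x < j)%N) //=.
  apply: eq_bigr => j xj; rewrite sum1_count; apply: eq_count => y /=.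
  by rewrite /asc andbC; case: eqP => [->|//]; rewrite xj.
apply: leq_trans (_ : \sum_(i < n) ((x == i) * (\sum_(j < n | i < j) count_mem j w)
   + \sum_(j < n | i < j) count_mem i w * count_mem j w) <= _)%N.
  by rewrite big_split /= leq_add // [X in (_ <= X)%N](bigD1 x) //= eqxx mul1n leq_addr.
apply: leq_sum => i _; rewrite big_distrr -big_split /=; apply: leq_sum => j ij.
by rewrite -mulnDl leq_mul // leq_addl.
Qed.

Lemma full_size_le w L : full w -> sweep w L ->
  (size L <= \sum_(i < n) \sum_(j < n | i < j) a i * a j + \sum_(i < n) a i + 1)%N.
Proof.
move=> fw sL; rewrite (sweep_size sL) addn1 -addnS leq_add //.
  apply: leq_trans (inversions_le w) _.
  by apply: leq_sum => i _; apply: leq_sum => j _; rewrite !fw.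
by rewrite -count_sum_size ltnS; apply: leq_sum => i _; rewrite fw.
Qed.

End Sweeps.

(** * Horizontal moves in a tiling and the incidence properties they yield *)

Section Geometry.
Variables (R : realType) (n : nat) (a : 'I_n -> nat) (theta : 'I_n -> R).
Hypothesis theta_bound : forall i, 0 < theta i < pi.
Hypothesis theta_incr : forall i j : 'I_n, (i < j)%N -> theta i < theta j.
Notation lattice := {ffun 'I_n -> nat}.
Notation vec := 'rV[R]_n.

Let sn i : R := sin (theta i).
Let cross (i k : 'I_n) : R := sin (theta k - theta i).

Let sn_gt0 i : 0 < sn i.
Proof. exact: sin_gt0_pi. Qed.

Let cross_gt0 (i k : 'I_n) : (i < k)%N -> 0 < cross i k.
Proof.
move=> ik; apply: sin_gt0_pi.
have := theta_bound i; have := theta_bound k; have := theta_incr ik.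
by move=> h /andP[h1 h2] /andP[h3 h4]; apply/andP; split; lra.
Qed.

Let sn_le1 i : sn i <= 1. Proof. exact: sin_le1. Qed.
Let cross_le1 i k : cross i k <= 1. Proof. exact: sin_le1. Qed.

Lemma planar_proj_eq (x y : vec) : planar_proj theta x = planar_proj theta y <->
  \sum_i x ord0 i * cos (theta i) = \sum_i y ord0 i * cos (theta i) /\
  \sum_i x ord0 i * sin (theta i) = \sum_i y ord0 i * sin (theta i).
Proof.
have E (z : vec) (k : 'I_2) : planar_proj theta z ord0 k =
    \sum_i z ord0 i * (if k == ord0 then cos (theta i) else sin (theta i)).
  by rewrite /planar_proj summxE; apply: eq_bigr => i _; rewrite !mxE.
split=> [e|[ec es]].
  have := congr1 (fun u : 'rV_2 => u ord0 ord0) e.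
  have := congr1 (fun u : 'rV_2 => u ord0 (lift ord0 ord0)) e.
  by rewrite !E.
by apply/rowP=> k; rewrite !E; case: eqP.
Qed.

Lemma planar_projD (x y : vec) :
  planar_proj theta (x + y) = planar_proj theta x + planar_proj theta y.
Proof.
by rewrite /planar_proj -big_split /=; apply: eq_bigr => i _; rewrite mxE scalerDl.
Qed.

Lemma planar_projZ s (x : vec) : planar_proj theta (s *: x) = s *: planar_proj theta x.
Proof.
by rewrite /planar_proj scaler_sumr; apply: eq_bigr => i _; rewrite mxE scalerA.
Qed.

(* For i < k the only combination of v_i and v_k equal to (1, 0). *)
Definition hstep (i k : 'I_n) : vec :=
  \row_j (if j == i then sn k / cross i k else if j == k then - (sn i / cross i k) else 0).

Definition e1 : 'rV[R]_2 := \row_(k < 2) (if k == ord0 then 1 else 0).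

Lemma hstepE (i k : 'I_n) : (i < k)%N ->
  [/\ hstep i k ord0 i = sn k / cross i k, hstep i k ord0 k = - (sn i / cross i k)
    & forall j, j != i -> j != k -> hstep i k ord0 j = 0].
Proof.
move=> ik; have ki : k != i by rewrite -val_eqE /=; lia.
split; first by rewrite mxE eqxx.
  by rewrite mxE (negPf ki) eqxx.
by move=> j /negPf ji /negPf jk; rewrite mxE ji jk.
Qed.

Lemma planar_proj_supp2 (x : vec) (i k : 'I_n) : i != k ->
  (forall j, j != i -> j != k -> x ord0 j = 0) ->
  planar_proj theta x = x ord0 i *: dirvec (theta i) + x ord0 k *: dirvec (theta k).
Proof.
move=> ik x0; rewrite /planar_proj (bigD1 i) //= (bigD1 k) /=; last by rewrite eq_sym.
by rewrite big1 ?addr0 // => j /andP[ji jk]; rewrite x0 // scale0r.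
Qed.

Lemma planar_proj_hstep (i k : 'I_n) : (i < k)%N -> planar_proj theta (hstep i k) = e1.
Proof.
move=> ik; have [hi hk h0] := hstepE ik; have ik' : i != k by rewrite -val_eqE /=; lia.
rewrite (planar_proj_supp2 ik' h0) hi hk; have := cross_gt0 ik; rewrite /cross sinB => c0.
apply/rowP=> j; rewrite !mxE /sn; case: eqP => _; field; rewrite gt_eqF //.
Qed.

Lemma hstep_unique (i k : 'I_n) (x : vec) h : (i < k)%N ->
  (forall j, j != i -> j != k -> x ord0 j = 0) -> planar_proj theta x = h *: e1 ->
  x = h *: hstep i k.
Proof.
move=> ik x0; have [hi hk h0] := hstepE ik; have ik' : i != k by rewrite -val_eqE /=; lia.
rewrite (planar_proj_supp2 ik' x0) => e.
have := congr1 (fun u : 'rV_2 => u ord0 ord0) e.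
have := congr1 (fun u : 'rV_2 => u ord0 (lift ord0 ord0)) e.
rewrite !mxE /= mulr0 mulr1 => es ec.
have c0 := cross_gt0 ik; have cE : cross i k = sn k * cos (theta i) - cos (theta k) * sn i by exact: sinB.
have xi : x ord0 i * cross i k = h * sn k.
  rewrite cE -ec; transitivity ((x ord0 i * cos (theta i) + x ord0 k * cos (theta k)) * sn k -
     (x ord0 i * sin (theta i) + x ord0 k * sin (theta k)) * cos (theta k)).
    by rewrite /sn; ring.
  by rewrite es mul0r subr0.
have xk : x ord0 k * cross i k = - (h * sn i).
  rewrite cE -ec; transitivity (- (x ord0 i * cos (theta i) + x ord0 k * cos (theta k)) * sn i +
     (x ord0 i * sin (theta i) + x ord0 k * sin (theta k)) * cos (theta i)).
    by rewrite /sn; ring.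
  by rewrite es mul0r addr0 mulNr.
have cn0 : cross i k != 0 by rewrite gt_eqF.
apply/rowP=> j; rewrite [RHS]mxE.
have [->|ji] := eqVneq j i; first by rewrite hi mulrA -xi mulfK.
have [->|jk] := eqVneq j k; first by rewrite hk mulrN mulrA -[RHS]mulNr -xk mulfK.
by rewrite h0 // mulr0 x0.
Qed.

(** A point in the relative interior of the cell [(I, D)]: any cell containing it has [(I, D)] as a
    face, which is how points are turned into cells of [T]. *)
Definition half_point (I : lattice) (D : {set 'I_n}) : vec :=
  \row_j ((I j)%:R + (if j \in D then 2^-1 else 0)).

Definition to_grid (I : lattice) : grid a := [ffun i => inord (I i)].

Lemma to_gridE I i : in_box a I -> to_grid I i = I i :> nat.
Proof. by move=> bI; rewrite ffunE inordK // ltnS; exact: bI. Qed.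

Lemma cell_half_point I D : in_box a I -> cell_set (to_grid I, D) (half_point I D).
Proof.
move=> bI i /=; rewrite mxE to_gridE //; split=> [->|/negPf ->]; last by rewrite addr0.
by apply/andP; split; lra.
Qed.

Lemma nat_le_half (p q : nat) : (p%:R : R) <= q%:R + 2^-1 -> (p <= q)%N.
Proof.
move=> h; rewrite -ltnS -(ltr_nat R) -natr1; lra.
Qed.

Lemma nat_half_le (p q : nat) : (p%:R : R) + 2^-1 <= q%:R + 1 -> (p <= q)%N.
Proof.
move=> h; rewrite -ltnS -(ltr_nat R) -natr1; lra.
Qed.

Lemma nat_half_neq (p q : nat) : (p%:R : R) + 2^-1 = q%:R -> False.
Proof.
move=> h; have : (p < q)%N by rewrite -(ltr_nat R); lra.
by rewrite -(ler_nat R) -natr1; lra.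
Qed.

Variable T : {set cell a}.
Hypothesis T_sub : subcomplex T.
Hypothesis T_dim : complex_dim T = 2%N.
Hypothesis T_bij : set_bij (realization (R := R) T) (shadow a theta) (planar_proj theta).

Lemma T_inj (x y : vec) (c d : cell a) : c \in T -> cell_set c x -> d \in T -> cell_set d y ->
  planar_proj theta x = planar_proj theta y -> x = y.
Proof.
have [_ inj _] := T_bij; move=> cT cx dT dy e.
by apply: inj => //; rewrite inE; [exists c|exists d].
Qed.

Lemma T_surj (x : vec) : cube_box a x ->
  exists z (c : cell a), [/\ c \in T, cell_set c z & planar_proj theta z = planar_proj theta x].
Proof.
have [_ _ surj] := T_bij; move=> bx.
have [z [c cT cz] e] : (planar_proj theta @` realization T)%classic (planar_proj theta x).
  by apply: surj; exists x.
by exists z, c.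
Qed.

Lemma cell_in_box (c : cell a) (x : vec) : c \in T -> cell_set c x -> cube_box a x.
Proof.
have [fitT _] := T_sub; move=> /fitT/forall_inP fc cx i; have [h1 h2] := cx i.
have [ic|ic] := boolP (i \in c.2).
  have := h1 ic; have : ((c.1 i).+1%:R : R) <= (a i)%:R by rewrite ler_nat fc.
  have : 0 <= (c.1 i)%:R :> R by exact: ler0n.
  rewrite -natr1 => g1 g2 /andP[g3 g4]; apply/andP; split; lra.
by rewrite h2 // ler0n ler_nat -ltnS ltn_ord.
Qed.

Lemma half_point_face I D (c : cell a) : in_box a I -> c \in T ->
  cell_set c (half_point I D) -> (to_grid I, D) \in T.
Proof.
move=> bI cT cx; have [_ faceT] := T_sub; apply: (faceT c) => //.
have Dc : D \subset c.2.
  apply/fintype.subsetP => i iD; apply/negPn/negP => ic; have [_ /(_ ic)] := cx i.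
  by rewrite mxE iD => /nat_half_neq.
rewrite /face /= Dc /=; apply/existsP.
(* The face is the upper one exactly in those directions where the integral coordinate of the point
   is the upper end of the interval of [c]. *)
exists [set i in c.2 :\: D | (c.1 i < I i)%N]%SET; apply/andP; split.
  by apply/fintype.subsetP => i; rewrite inE => /andP[].
apply/eqP/ffunP => i; apply: ord_inj; rewrite to_gridE // ffunE inE inE.
have [h1 h2] := cx i; rewrite mxE in h1 h2.
have [ic|ic] := boolP (i \in c.2); last first.
  have /negPf iD : i \notin D by apply: contra ic => /(fintype.subsetP Dc).
  move: (h2 ic); rewrite iD addr0 => /eqP; rewrite eqr_nat => /eqP e.
  by rewrite andbF addn0 inordK ?e // -e ltnS bI.
have := h1 ic; have [iD|iD] := boolP (i \in D) => /andP[/= g1 g2].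
  have e : I i = c.1 i by apply/eqP; rewrite eqn_leq (nat_le_half g1) (nat_half_le g2).
  by rewrite addn0 inordK ?e // -e ltnS bI.
rewrite addr0 natr1 !ler_nat in g1 g2.
have [lt|ge] := ltnP (c.1 i) (I i).
  have e : I i = (c.1 i).+1 by apply/eqP; rewrite eqn_leq g2 lt.
  by rewrite /= addn1 inordK -e // ltnS bI.
have e : I i = c.1 i by apply/eqP; rewrite eqn_leq ge g1.
by rewrite addn0 inordK ?e // -e ltnS bI.
Qed.

(** Every moved point is covered by [T], and there are finitely many cells, so one of them serves
    for arbitrarily small moves. *)
Lemma cell_near (x : vec) (s h0 : R) : 0 < h0 ->
  (forall h, 0 < h <= h0 -> exists y, cube_box a y /\
     planar_proj theta y = planar_proj theta x + (s * h) *: e1) ->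
  exists2 c : cell a, c \in T & forall e, 0 < e -> exists h z,
    [/\ 0 < h < e, cell_set c z & planar_proj theta z = planar_proj theta x + (s * h) *: e1].
Proof.
move=> h0gt0 near; apply: contrapT => H.
have /choice[e eP] : forall c : cell a, exists e : R, 0 < e /\ (c \in T -> forall h z,
    0 < h < e -> cell_set c z -> planar_proj theta z <> planar_proj theta x + (s * h) *: e1).
  move=> c; apply: contrapT => H1; apply: H.
  have [cT|cT] := boolP (c \in T); last by case: H1; exists 1; split=> //; rewrite (negPf cT).
  exists c => // e e0; apply: contrapT => H2; apply: H1; exists e; split=> // _ h z h1 cz pz.
  by apply: H2; exists h, z.
pose m := \big[Num.min/h0]_(c in T) e c.
have m0 : 0 < m.
  rewrite /m; elim/big_ind: _ => // [u v u0 v0|c _]; first by rewrite lt_min u0.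
  by have [] := eP c.
have mh0 : m <= h0.
  by rewrite /m; elim/big_rec: _ => // c y _ yh; rewrite ge_min yh orbT.
have [y [by_ py]] : exists y, cube_box a y /\
     planar_proj theta y = planar_proj theta x + (s * (m / 2)) *: e1.
  by apply: near; apply/andP; split; lra.
have [z [c [cT cz pz]]] := T_surj by_.
have [_ /(_ cT (m / 2) z)] := eP c; apply=> //; last by rewrite pz.
apply/andP; split; first by lra.
have : m <= e c by rewrite /m (bigD1 c) //= ge_min lexx.
by lra.
Qed.

(** The cell given by [cell_near] has dimension two, because a cell with at most one direction
    contains no horizontal displacement. Letting the move tend to 0 inside this closed cell gives a
    point with the projection of [x], and by injectivity this point is [x]. *)
Lemma horizontal_tile (x : vec) (c0 : cell a) (s h0 : R) :
  s != 0 -> c0 \in T -> cell_set c0 x -> 0 < h0 ->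
  (forall h, 0 < h <= h0 -> exists y, cube_box a y /\
     planar_proj theta y = planar_proj theta x + (s * h) *: e1) ->
  exists (J : grid a) (i k : 'I_n) h, [/\ (i < k)%N, 0 < h, (J, [set i; k]%SET) \in T,
    cell_set (J, [set i; k]%SET) x & cell_set (J, [set i; k]%SET) (x + (s * h) *: hstep i k)].
Proof.
move=> s0 c0T c0x h0gt0 near.
have [[J D] cT cnear] := cell_near h0gt0 near.
have [h1 [z1 [/andP[h1gt0 _] cz1 pz1]]] := cnear 1 ltr01.
have [h2 [z2 [/andP[h2gt0 h21] cz2 pz2]]] := cnear h1 h1gt0.
have suppD (z z' : vec) : cell_set (J, D) z -> cell_set (J, D) z' ->
    forall j, j \notin D -> (z - z') ord0 j = 0.
  move=> cz cz' j jD; have [_ /(_ jD) e] := cz j; have [_ /(_ jD) e'] := cz' j.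
  by rewrite !mxE e e' subrr.
have pdiff (z z' : vec) h h' : planar_proj theta z = planar_proj theta x + (s * h) *: e1 ->
    planar_proj theta z' = planar_proj theta x + (s * h') *: e1 ->
    planar_proj theta (z - z') = (s * (h - h')) *: e1.
  move=> e e'; rewrite planar_projD -scaleN1r planar_projZ e e' scaleN1r.
  by rewrite opprD addrACA subrr add0r -scalerBl mulrBr.
have pd := pdiff _ _ _ _ pz1 pz2; have sd := suppD _ _ cz1 cz2.
have sh : s * (h1 - h2) != 0 by rewrite mulf_neq0 // subr_eq0 gt_eqF.
have D2 : (#|D| <= 2)%N by rewrite -T_dim /complex_dim (bigD1 (J, D)) //= leq_maxl.
have [i [k [ik DE]]] : exists i k : 'I_n, (i < k)%N /\ D = [set i; k]%SET.
  have not1 : ~ (exists i, D \subset [set i]%SET).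
    case=> i Di; have dj j : j != i -> (z1 - z2) ord0 j = 0.
      by move=> ji; apply: sd; apply: contra ji => /(fintype.subsetP Di); rewrite inE.
    have := pd; rewrite /planar_proj (bigD1 i) //= big1 ?addr0; last first.
      by move=> j /dj ->; rewrite scale0r.
    move=> e; have := congr1 (fun u : 'rV_2 => u ord0 (lift ord0 ord0)) e.
    rewrite [LHS]mxE [RHS]mxE [X in _ * X = _]mxE [X in _ = _ * X]mxE /= mulr0 => /eqP.
    rewrite mulf_eq0 => /orP[/eqP d0|/eqP si]; last by have := sn_gt0 i; rewrite /sn si ltxx.
    have := congr1 (fun u : 'rV_2 => u ord0 ord0) e.
    rewrite d0 scale0r mxE [RHS]mxE mxE /= mulr1 => /esym/eqP.
    by apply/negP.
  move: D2; rewrite leq_eqVlt => /orP[/cards2P[i [k [ik DE]]]|D1].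
    have [lt|ge] := ltnP i k; first by exists i, k.
    exists k, i; rewrite finset.setUC ltn_neqAle ge andbT; split=> //.
    by rewrite eq_sym.
  case: not1; move: D1; rewrite ltnS leq_eqVlt => /orP[/cards1P[i ->]|]; first by exists i.
  rewrite ltnS leqn0 cards_eq0 => /eqP D0; exfalso.
  have := pd; rewrite /planar_proj big1; last first.
    by move=> j _; rewrite sd ?scale0r // D0 inE.
  move=> /(congr1 (fun u : 'rV_2 => u ord0 ord0)).
  by rewrite !mxE /= mulr1 => /esym/eqP; apply/negP.
subst D.
have onseg h z : cell_set (J, [set i; k]%SET) z ->
    planar_proj theta z = planar_proj theta x + (s * h) *: e1 ->
    z = z1 + (s * (h - h1)) *: hstep i k.
  move=> cz pz; apply/eqP; rewrite addrC -subr_eq; apply/eqP.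
  apply: hstep_unique => //; last exact: pdiff.
  by move=> j ji jk; apply: suppD => //; rewrite !inE negb_or ji.
(* The points found lie on one line with direction [hstep i k]; this is its point for move 0. It
   lies in the cell as a limit of the points found. *)
pose x' := z1 - (s * h1) *: hstep i k.
have cx' : cell_set (J, [set i; k]%SET) x'.
  move=> j /=; split=> [jD|jD]; last first.
    have [_ /(_ jD) /= <-] := cz1 j; rewrite !mxE; move: jD; rewrite !inE negb_or.
    by move=> /andP[/negPf -> /negPf ->]; rewrite mulr0 subr0.
  have close e : 0 < e -> exists h z, [/\ cell_set (J, [set i; k]%SET) z,
      `|s * h * hstep i k ord0 j| <= e & z ord0 j = x' ord0 j + s * h * hstep i k ord0 j].
    move=> e0; pose q := 1 + `|s * hstep i k ord0 j|.
    have q0 : 0 < q by rewrite ltr_pwDl.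
    have [h [z [/andP[hgt0 he] cz pz]]] := cnear (e / q) (divr_gt0 e0 q0).
    exists h, z; split=> //.
      rewrite mulrAC normrM (gtr0_norm hgt0) mulrC.
      apply: le_trans (_ : h * q <= _); last by rewrite -ler_pdivlMr // ltW.
      by rewrite ler_pM2l // lerDr.
    by rewrite (onseg h z cz pz) !mxE; ring.
  apply/andP; split.
    apply/ler_addgt0Pr => e e0; have [h [z [cz hle zE]]] := close e e0.
    have [/(_ jD)/andP[lo _] _] := cz j; rewrite zE in lo.
    have := ler_norm (s * h * hstep i k ord0 j); move: lo hle => /=.
    by move: (s * h * _) => t; lra.
  apply/ler_addgt0Pr => e e0; have [h [z [cz hle zE]]] := close e e0.
  have [/(_ jD)/andP[_ hi] _] := cz j; rewrite zE in hi.
  have := ler_norm (- (s * h * hstep i k ord0 j)); rewrite normrN; move: hi hle => /=.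
  by move: (s * h * _) => t; lra.
have xE : x' = x.
  apply: (T_inj cT cx' c0T c0x).
  rewrite planar_projD pz1 -scaleNr planar_projZ planar_proj_hstep // scaleNr.
  by rewrite addrK.
exists J, i, k, h1; split=> //; first by rewrite -xE.
by rewrite -xE /x' subrK.
Qed.

Definition of_grid (J : grid a) : lattice := [ffun i => (J i : nat)].

Lemma of_grid_box J : in_box a (of_grid J).
Proof. by move=> i; rewrite ffunE -ltnS ltn_ord. Qed.

Lemma of_gridK J : to_grid (of_grid J) = J.
Proof. by apply/ffunP=> i; apply: ord_inj; rewrite to_gridE ?ffunE //; exact: of_grid_box. Qed.

Definition tvertex I : Prop := in_box a I /\ (to_grid I, finset.set0) \in T.
Definition tedge I i : Prop := in_box a (shift I [:: i]) /\ (to_grid I, [set i]%SET) \in T.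
Definition ttile I i k : Prop :=
  in_box a (shift I [:: i; k]) /\ (to_grid I, [set i; k]%SET) \in T.

Lemma shift_box I s : in_box a (shift I s) -> in_box a I.
Proof. by move=> b i; apply: leq_trans (b i); rewrite ffunE leq_addr. Qed.

Lemma subface I I' (D D' : {set 'I_n}) : in_box a I -> in_box a I' ->
  (to_grid I, D) \in T -> D' \subset D ->
  (forall j, I' j = I j \/ [/\ j \in D, j \notin D' & I' j = (I j).+1]) ->
  (to_grid I', D') \in T.
Proof.
move=> bI bI' cT D'D II'; apply: (half_point_face bI' cT) => j /=.
rewrite mxE to_gridE //; split=> jD.
  have [jD'|jD'] := boolP (j \in D').
    by case: (II' j) => [->|[_]]; [apply/andP; split; lra | rewrite jD'].
  by case: (II' j) => [->|[_ _ ->]]; rewrite -?natr1; apply/andP; split; lra.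
have /negPf -> : j \notin D' by apply: contra jD => /(fintype.subsetP D'D).
by case: (II' j) => [->|[]]; rewrite ?addr0 // (negPf jD).
Qed.

Lemma ttile_edges I (i k : 'I_n) : (i < k)%N -> ttile I i k ->
  [/\ tedge I i, tedge I k & tedge (shift I [:: k]) i].
Proof.
move=> ik [b cT]; have bI := shift_box b.
have ik' : i != k by rewrite -val_eqE /=; lia.
have bs s : (forall x, (count_mem x s <= count_mem x [:: i; k])%N) -> in_box a (shift I s).
  by move=> h x; apply: leq_trans (b x); rewrite !ffunE leq_add2l.
have bi : in_box a (shift I [:: i]) by apply: bs => x /=; rewrite leq_add2l.
have bk : in_box a (shift I [:: k]) by apply: bs => x /=; rewrite leq_addl.
split; split=> //.
- by apply: (subface bI bI cT) => [|j]; [rewrite finset.sub1set !inE eqxx | left].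
- by apply: (subface bI bI cT) => [|j]; [rewrite finset.sub1set !inE eqxx orbT | left].
- by rewrite shift_cat (shift_perm I (t := [:: i; k])) // perm_catC.
apply: (subface bI bk cT) => [|j]; first by rewrite finset.sub1set !inE eqxx.
rewrite ffunE /= addn0; case: eqP => [<-|_]; last by left; rewrite addn0.
by right; rewrite !inE eqxx orbT addn1 eq_sym.
Qed.

Lemma tedge_vertices I i : tedge I i -> tvertex I /\ tvertex (shift I [:: i]).
Proof.
move=> [b cT]; have bI := shift_box b; split; split=> //.
  by apply: (subface bI bI cT) => [|j]; [rewrite finset.sub0set | left].
apply: (subface bI b cT) => [|j]; first by rewrite finset.sub0set.
rewrite ffunE /= addn0; case: eqP => [<-|_]; last by left; rewrite addn0.
by right; rewrite !inE eqxx addn1.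
Qed.

Lemma tile_box (J : grid a) (i k : 'I_n) : i != k -> (J, [set i; k]%SET) \in T ->
  in_box a (shift (of_grid J) [:: i; k]).
Proof.
move=> ik cT j; have [fitT _] := T_sub; have /forall_inP fj := fitT _ cT.
rewrite !ffunE /= addn0; have := fj j; rewrite /= !inE [j == i]eq_sym [j == k]eq_sym.
case: eqP => [<-|_] /=; first by rewrite (negPf (_ : k != i)) 1?eq_sym // addn0 addn1; apply.
by case: eqP => [_|_] /=; rewrite ?add0n ?addn1 => h; [apply: h | rewrite ?addn0 -ltnS ltn_ord].
Qed.

Lemma hstep_ratio (i k j : 'I_n) h : (i < k)%N -> 0 < h <= cross i k ->
  0 < h * (sn j / cross i k) <= 1.
Proof.
move=> ik /andP[h0 hc]; have c0 := cross_gt0 ik; apply/andP; split.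
  by rewrite mulr_gt0 // divr_gt0.
rewrite mulrA ler_pdivrMr // mul1r; apply: le_trans hc.
by rewrite -[X in _ <= X]mulr1 ler_pM2l // sn_le1.
Qed.

Lemma addZE (x y : vec) t j : (x + t *: y) ord0 j = x ord0 j + t * y ord0 j.
Proof. by rewrite !mxE. Qed.

Lemma hmove_box (x : vec) (i k : 'I_n) t : (i < k)%N -> cube_box a x ->
  0 <= x ord0 i + t * (sn k / cross i k) <= (a i)%:R ->
  0 <= x ord0 k - t * (sn i / cross i k) <= (a k)%:R ->
  cube_box a (x + t *: hstep i k).
Proof.
move=> ik bx xi xk j; rewrite addZE; have [hi hk h0] := hstepE ik.
have [->|ji] := eqVneq j i; first by rewrite hi.
have [->|jk] := eqVneq j k; first by rewrite hk mulrN.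
by rewrite h0 // mulr0 addr0; exact: bx.
Qed.

Lemma natR_lt (p q : nat) : (p%:R : R) < q%:R + 1 -> (p <= q)%N.
Proof. by rewrite natr1 ltr_nat ltnS. Qed.

Lemma natR_succ_le (p q : nat) : (p < q)%N -> (p%:R : R) + 1 <= q%:R.
Proof. by rewrite natr1 ler_nat. Qed.

(** The hypotheses on [i] and [k] leave room for a move to the right. In the tile entered, with
    directions p < q, this move raises coordinate p and lowers coordinate q, so [v] is at the bottom
    for p and at the top for q: it is the left vertex. *)
Lemma tvertex_left_tile v (i k : 'I_n) : tvertex v -> (i < k)%N ->
  (v i < a i)%N -> (0 < v k)%N ->
  exists I (i' k' : 'I_n), [/\ (i' < k')%N, ttile I i' k' & v = shift I [:: k']].
Proof.
move=> [bv vT] ik vi vk.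
pose x := half_point v finset.set0.
have xE j : x ord0 j = (v j)%:R by rewrite mxE inE addr0.
have cvx : cell_set (to_grid v, finset.set0) x by exact: cell_half_point.
have near h : 0 < h <= cross i k -> exists y, cube_box a y /\
    planar_proj theta y = planar_proj theta x + (1 * h) *: e1.
  move=> hc; exists (x + h *: hstep i k); split; last first.
    by rewrite planar_projD planar_projZ planar_proj_hstep // mul1r.
  have /andP[u0 u1] := hstep_ratio k ik hc; have /andP[w0 w1] := hstep_ratio i ik hc.
  have g1 := natR_succ_le vi; have g2 := natR_succ_le vk.
  have g3 : (0 : R) <= (v i)%:R by exact: ler0n.
  have g4 : ((v k)%:R : R) <= (a k)%:R by rewrite ler_nat bv.
  apply: hmove_box => //; first exact: cell_in_box cvx.
    by rewrite xE; apply/andP; split; lra.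
  by rewrite xE; apply/andP; split; lra.
have [J [p [q [h [pq hgt0 cT cx cx2]]]]] :=
  horizontal_tile (oner_neq0 _) vT cvx (cross_gt0 ik) near.
have [hp hq h0] := hstepE pq; have pq' : p != q by rewrite -val_eqE /=; lia.
exists (of_grid J), p, q; split=> //.
  by split; [exact: tile_box | rewrite of_gridK].
apply/ffunP=> j; rewrite !ffunE /= addn0.
have [cj1 cj2] := cx j; have [dj1 dj2] := cx2 j; move: cj1 cj2 dj1 dj2.
rewrite /= addZE !inE xE mul1r => cj1 cj2 dj1 dj2.
have r0 u : 0 < h * (sn u / cross p q) by rewrite mulr_gt0 // divr_gt0 ?cross_gt0.
have [jq|jq] := eqVneq q j.
  move: dj1 cj1; rewrite -jq eqxx orbT hq mulrN => /(_ isT)/andP[g1 _] /(_ isT)/andP[_ g2].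
  apply/eqP; rewrite eqn_leq addn1; apply/andP; split.
    by move: g2; rewrite natr1 ler_nat.
  by rewrite -(ltr_nat R); have := r0 p; lra.
have [jp|jp] := eqVneq p j.
  move: dj1 cj1; rewrite -jp eqxx hp => /(_ isT)/andP[_ g1] /(_ isT)/andP[g2 _].
  apply/eqP; rewrite eqn_leq addn0; apply/andP; split.
    by apply: natR_lt; have := r0 q; lra.
  by rewrite -(ler_nat R).
move: cj2; rewrite eq_sym (negPf jp) eq_sym (negPf jq) => /(_ isT)/eqP.
by rewrite eqr_nat addn0 => /eqP.
Qed.

(** A move to the left from the midpoint of the edge. The half-integral coordinate forces [i] to be
    a direction of the tile entered, and the sign of the move in the other direction tells whether
    the edge is the lower or the upper right side. *)
Lemma tedge_left_tile I (i k : 'I_n) : tedge I i ->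
  ((i < k)%N && (I k < a k)%N) || ((k < i)%N && (0 < I k)%N) ->
  (exists2 k' : 'I_n, (i < k')%N & ttile I i k') \/
  (exists I' (k' : 'I_n), [/\ (k' < i)%N, I = shift I' [:: k'] & ttile I' k' i]).
Proof.
move=> [b eT] side; have bI := shift_box b.
have Ii : (I i < a i)%N by have := b i; rewrite ffunE /= eqxx addn0 addn1.
pose x := half_point I [set i]%SET.
have xi : x ord0 i = (I i)%:R + 2^-1 by rewrite mxE inE eqxx.
have xj j : j != i -> x ord0 j = (I j)%:R by move=> ji; rewrite mxE inE (negPf ji) addr0.
have cIx : cell_set (to_grid I, [set i]%SET) x by exact: cell_half_point.
have bx := cell_in_box eT cIx.
have half (p q u : 'I_n) h : (p < q)%N -> 0 < h <= cross p q / 2 ->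
    0 < h * (sn u / cross p q) <= 2^-1.
  move=> pq /andP[hgt0 hc]; have : 0 < 2 * h <= cross p q by apply/andP; split; lra.
  by move=> /(hstep_ratio u pq); rewrite -mulrA; move: (h * _) => t /andP[]; lra.
have [h0 h0gt0 near] : exists2 h0 : R, 0 < h0 & forall h, 0 < h <= h0 -> exists y, cube_box a y /\
    planar_proj theta y = planar_proj theta x + (-1 * h) *: e1.
  have g1 := natR_succ_le Ii; have g3 : (0 : R) <= (I i)%:R by exact: ler0n.
  have g5 : (0 : R) <= (I k)%:R by exact: ler0n.
  have g6 : ((I k)%:R : R) <= (a k)%:R by rewrite ler_nat bI.
  case/orP: side => /andP[lt Ik]; have g2 := natR_succ_le Ik.
    have ki : k != i by rewrite -val_eqE /=; lia.
    (* Half the bound of [hstep_ratio], since the midpoint has room 1/2 in direction [i]. *)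
    exists (cross i k / 2); first by have := cross_gt0 lt; lra.
    move=> h hc; exists (x + (-1 * h) *: hstep i k); split; last first.
      by rewrite planar_projD planar_projZ planar_proj_hstep.
    have /andP[u0 u1] := half _ _ k _ lt hc; have /andP[w0 w1] := half _ _ i _ lt hc.
    apply: hmove_box => //; rewrite ?xi ?xj // -mulrA mulN1r ?opprK.
      by apply/andP; split; lra.
    by apply/andP; split; lra.
  have ki : k != i by rewrite -val_eqE /=; lia.
  exists (cross k i / 2); first by have := cross_gt0 lt; lra.
  move=> h hc; exists (x + (-1 * h) *: hstep k i); split; last first.
    by rewrite planar_projD planar_projZ planar_proj_hstep.
  have /andP[u0 u1] := half _ _ k _ lt hc; have /andP[w0 w1] := half _ _ i _ lt hc.
  apply: hmove_box => //; rewrite ?xi ?xj // -mulrA mulN1r ?opprK.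
    by apply/andP; split; lra.
  by apply/andP; split; lra.
have sN0 : -1 != 0 :> R by rewrite oppr_eq0 oner_eq0.
have [J [p [q [h [pq hgt0 cT cx cx2]]]]] := horizontal_tile sN0 eT cIx h0gt0 near.
have [hp hq hz] := hstepE pq; have pq' : p != q by rewrite -val_eqE /=; lia.
have qp' : q != p by rewrite eq_sym.
have r0 u : 0 < h * (sn u / cross p q) by rewrite mulr_gt0 // divr_gt0 ?cross_gt0.
have F : ttile (of_grid J) p q by split; [exact: tile_box | rewrite of_gridK].
have Jj j : j != p -> j != q -> j != i -> I j = J j.
  move=> jp jq ji; have [_] := cx j; rewrite /= !inE (negPf jp) (negPf jq) xj //.
  by move=> /(_ isT)/eqP; rewrite eqr_nat => /eqP.
have Ji : (i == p) || (i == q) -> I i = J i.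
  move=> iD; have [] := cx i; rewrite /= !inE iD xi => /(_ isT)/andP[g1 g2] _.
  by apply/eqP; rewrite eqn_leq (nat_le_half g1) (nat_half_le g2).
have : (i == p) || (i == q).
  apply/negPn/negP => iD; have [_] := cx i; rewrite /= !inE iD xi => /(_ isT).
  exact: nat_half_neq.
case/orP=> /eqP ie; subst i.
- left; exists q => //; suff -> : I = of_grid J by [].
  apply/ffunP=> j; rewrite ffunE; have [->|jp] := eqVneq j p; first by apply: Ji; rewrite eqxx.
  have [->|jq] := eqVneq j q; last exact: Jj.
  have [] := cx q; have [] := cx2 q; rewrite /= addZE !inE eqxx orbT hq xj //.
  rewrite mulN1r mulrNN => /(_ isT)/andP[_ g1] _ /(_ isT)/andP[g2 _] _.
  apply/eqP; rewrite eqn_leq; apply/andP; split; last by rewrite -(ler_nat R).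
  by apply: natR_lt; have := r0 p; lra.
right; exists (of_grid J), p; split=> //.
apply/ffunP=> j; rewrite !ffunE /= addn0; have [<-|jp] := eqVneq p j.
  have [] := cx p; have [] := cx2 p; rewrite /= addZE !inE eqxx hp xj //.
  rewrite mulN1r mulNr => /(_ isT)/andP[g1 _] _ /(_ isT)/andP[_ g2] _.
  apply/eqP; rewrite eqn_leq addn1; apply/andP; split.
    by move: g2; rewrite natr1 ler_nat.
  by rewrite -(ltr_nat R); have := r0 q; lra.
rewrite addn0; have [->|jq] := eqVneq j q; first by apply: Ji; rewrite eqxx orbT.
by apply: Jj => //; rewrite eq_sym.
Qed.

(** A small move to the left from the common right vertex enters both tiles. By injectivity the two
    displacements agree, and the signs of its coordinates recover the two directions. *)
Lemma ttile_right_vertex_inj I I' (i k i' k' : 'I_n) : (i < k)%N -> (i' < k')%N ->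
  ttile I i k -> ttile I' i' k' -> shift I [:: i] = shift I' [:: i'] ->
  [/\ I = I', i = i' & k = k'].
Proof.
move=> ik ik' [b cT] [b' cT'] vE.
(* Sines are at most 1, so the product is at most each factor and is an admissible move in both
   tiles. *)
pose h := cross i k * cross i' k'.
have c0 := cross_gt0 ik; have c0' := cross_gt0 ik'.
have hgt0 : 0 < h by rewrite mulr_gt0.
have inside (J : lattice) (p q : 'I_n) : (p < q)%N -> h <= cross p q ->
    in_box a (shift J [:: p; q]) ->
    cell_set (to_grid J, [set p; q]%SET) (half_point (shift J [:: p]) finset.set0 + (- h) *: hstep p q).
  move=> pq hc bJ j /=; have bJ0 := shift_box bJ; rewrite addZE to_gridE // mxE !inE addr0 ffunE /= addn0.
  have hc' : 0 < h <= cross p q by rewrite hgt0.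
  have [hp hq hz] := hstepE pq; have pq' : p != q by rewrite -val_eqE /=; lia.
  have /andP[u0 u1] := hstep_ratio q pq hc'; have /andP[w0 w1] := hstep_ratio p pq hc'.
  have [->|jp] := eqVneq j p.
    split=> // _; rewrite ?eqxx addn1 hp mulNr -natr1; apply/andP; split; lra.
  have [->|jq] := eqVneq j q.
    split=> // _; rewrite ?(negPf pq') addn0 hq mulrNN; apply/andP; split; lra.
  by split=> // _; rewrite hz // mulr0 addr0 addn0.
have hle : h <= cross i k by rewrite -[X in _ <= X]mulr1 ler_pM2l // cross_le1.
have hle' : h <= cross i' k' by rewrite -[X in _ <= X]mul1r ler_pM2r // cross_le1.
have cz := inside _ _ _ ik hle b; have cz' := inside _ _ _ ik' hle' b'.
have := T_inj cT cz cT' cz'.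
rewrite !planar_projD !planar_projZ !planar_proj_hstep // vE => /(_ erefl)/addrI sE.
have {sE}E : hstep i k = hstep i' k'.
  by apply: (scalerI _ sE); rewrite oppr_eq0 gt_eqF.
have [hi hk hz] := hstepE ik; have [hi' hk' hz'] := hstepE ik'.
have pos u (p q : 'I_n) : (p < q)%N -> 0 < sn u / cross p q.
  by move=> pq; rewrite divr_gt0 ?cross_gt0.
have ii : i = i'.
  apply/eqP/negPn/negP => ni; have := pos k _ _ ik; rewrite -hi E.
  have [e|nk] := eqVneq i k'; last by rewrite hz' // ltxx.
  by rewrite e hk' oppr_gt0 ltNge ltW // pos.
subst i'; have kk : k = k'.
  apply/eqP/negPn/negP => nk; have := pos i _ _ ik; rewrite -oppr_lt0 -hk E.
  by rewrite hz' ?ltxx // -val_eqE /=; lia.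
split=> //; apply/ffunP=> j; move/ffunP/(_ j): vE; rewrite !ffunE.
exact: addIn.
Qed.

(* The boundary points have a unique preimage in the box, by the sign of
   their cross product with v_i. *)
Lemma tedge_right_boundary I (i : 'I_n) : in_box a I -> (I i < a i)%N ->
  (forall k : 'I_n, (k < i)%N -> I k = a k) ->
  (forall k : 'I_n, (i < k)%N -> I k = 0%N) -> tedge I i.
Proof.
move=> bI Ii lo hi; split.
  move=> j; rewrite ffunE /= addn0; case: eqP => [<-|_]; first by rewrite addn1.
  by rewrite addn0.
pose x := half_point I [set i]%SET.
have xi : x ord0 i = (I i)%:R + 2^-1 by rewrite mxE inE eqxx.
have xj j : j != i -> x ord0 j = (I j)%:R by move=> ji; rewrite mxE inE (negPf ji) addr0.
have bx : cube_box a x.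
  move=> j; have [->|ji] := eqVneq j i; last by rewrite xj // ler0n ler_nat bI.
  have g1 := natR_succ_le Ii; have g3 : (0 : R) <= (I i)%:R by exact: ler0n.
  by rewrite xi; apply/andP; split; lra.
have [z [c [cT cz /planar_proj_eq[ec es]]]] := T_surj bx.
have bz := cell_in_box cT cz.
suff zx : z = x by rewrite zx in cz; exact: half_point_face bI cT cz.
pose g j := (z ord0 j - x ord0 j) * sin (theta j - theta i).
have g0 : \sum_j g j = 0.
  rewrite /g; under eq_bigr do rewrite sinB.
  transitivity ((\sum_j z ord0 j * sin (theta j) - \sum_j x ord0 j * sin (theta j)) * cos (theta i)
    - (\sum_j z ord0 j * cos (theta j) - \sum_j x ord0 j * cos (theta j)) * sin (theta i)).
    rewrite -!sumrB !mulr_suml -sumrB; apply: eq_bigr => j _; ring.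
  by rewrite ec es !subrr !mul0r subrr.
have gge0 j : 0 <= g j.
  rewrite /g; have [ij|] := ltnP i j.
    have ji : j != i by rewrite -val_eqE /=; lia.
    rewrite mulr_ge0 ?(ltW (cross_gt0 ij)) // xj // hi // subr0.
    by have /andP[] := bz j.
  rewrite leq_eqVlt => /orP[/eqP/val_inj ->|ji]; first by rewrite subrr sin0 mulr0.
  have ji' : j != i by rewrite -val_eqE /=; lia.
  rewrite -[X in _ * X]opprK -sinN opprB mulrN -mulNr mulr_ge0 ?(ltW (cross_gt0 ji)) //.
  by rewrite oppr_ge0 subr_le0 xj // lo //; have /andP[] := bz j.
have zxj j : j != i -> z ord0 j = x ord0 j.
  move=> ji; have /eqP : g j = 0 by apply: (psumr_eq0P _ g0) => // j' _; exact: gge0.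
  rewrite mulf_eq0 subr_eq0 => /orP[/eqP //|/eqP s0].
  have [ij|] := ltnP i j; first by have := cross_gt0 ij; rewrite /cross s0 ltxx.
  rewrite leq_eqVlt => /orP[/eqP/val_inj e|ij]; first by rewrite e eqxx in ji.
  by have := cross_gt0 ij; rewrite /cross -opprB sinN s0 oppr0 ltxx.
apply/rowP=> j; have [->|] := eqVneq j i; last exact: zxj.
move: es; rewrite (bigD1 i) //= [RHS](bigD1 i) //=.
under eq_bigr => j' j'i do rewrite zxj //.
move=> /addIr/mulIf; apply; rewrite gt_eqF //; exact: sn_gt0.
Qed.

End Geometry.

(** * Counting grid points with at most two nonzero coordinates *)

Section SupportCount.
Variables (n : nat) (a : 'I_n -> nat).

Definition gsupp (J : grid a) : {set 'I_n} := [set i | (0 < J i)%N]%SET.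

Definition small_support (J : grid a) : bool := (#|gsupp J| <= 2)%N.

Lemma size_lsupp_of_grid (J : grid a) : size (lsupp (of_grid J)) = #|gsupp J|.
Proof.
rewrite cardE /lsupp enumT /enum_mem; congr size; apply: eq_filter => i.
by rewrite ffunE -[RHS]/(i \in gsupp J) inE.
Qed.

Lemma card_support (D : {set 'I_n}) :
  #|[pred J : grid a | gsupp J == D]| = (\prod_(i in D) a i)%N.
Proof.
pose F i : pred 'I_(a i).+1 := fun x => (0 < x)%N == (i \in D).
have -> : #|[pred J : grid a | gsupp J == D]| = #|(family F : simpl_pred (grid a))|.
  apply: eq_card => J; rewrite !inE; apply/eqP/familyP => [DE i|JF].
    by rewrite /= /in_mem /= /F -DE inE.
  by apply/setP => i; rewrite inE; have := JF i; rewrite /= /in_mem /= /F => /eqP.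
rewrite card_family foldrE big_map big_enum /= [RHS]big_mkcond /=.
apply: eq_bigr => i _; rewrite /F; case: (i \in D).
  rewrite -[RHS]/((a i).+1.-1) -[(a i).+1 in RHS]card_ord -(cardC1 (@ord0 (a i))).
  by apply: eq_card => x; rewrite !inE /in_mem /= eqb_id lt0n.
rewrite -[RHS](card1 (@ord0 (a i))); apply: eq_card => x.
by rewrite -[LHS]/((0 < x)%N == false) -[RHS]/(x == ord0) -val_eqE /=; case: (nat_of_ord x).
Qed.

Lemma sum_sets_le2 (G : {set 'I_n} -> nat) :
  (\sum_(D : {set 'I_n} | (#|D| <= 2)%N) G D =
   \sum_(i < n) \sum_(j < n | i < j) G [set i; j]%SET + \sum_(i < n) G [set i]%SET +
   G finset.set0)%N.
Proof.
rewrite (bigID (fun D : {set 'I_n} => #|D| == 2)) /=.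
rewrite [X in (_ + X = _)%N](bigID (fun D : {set 'I_n} => #|D| == 1)) /= addnA.
congr (_ + _ + _)%N.
- rewrite pair_big_dep /= -(big_imset (h := fun p : 'I_n * 'I_n => [set p.1; p.2]%SET) G
    (A := [pred p : 'I_n * 'I_n | (p.1 < p.2)%N])) /=; last first.
    move=> [i j] [k l] /=; rewrite !inE /= => ij kl /setP E.
    have : i \in [set k; l]%SET by rewrite -E !inE eqxx.
    have : j \in [set k; l]%SET by rewrite -E !inE eqxx orbT.
    have : k \in [set i; j]%SET by rewrite E !inE eqxx.
    rewrite !inE; do 3![case/orP=> /eqP ?]; subst => //; lia.
  apply: eq_bigl => D; apply/andP/imsetP => [[_ /cards2P[i [j [ij ->]]]]|[[i j] /=]].
    have [lt|ge] := ltnP i j; first by exists (i, j).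
    exists (j, i); last by rewrite /= finset.setUC.
    by rewrite inE /= ltn_neqAle ge andbT val_eqE eq_sym.
  by rewrite inE /= => ij ->; rewrite cards2 (negPf (_ : i != j)) ?neq_ltn ?ij // -val_eqE neq_ltn ij.
- rewrite -(big_imset (h := fun i : 'I_n => [set i]%SET) G (A := predT)) /=; last first.
    by move=> i j _ _ /set1_inj.
  apply: eq_bigl => D; apply/idP/imsetP => [/andP[_ /cards1P[i ->]]|[i _ ->]]; first by exists i.
  by rewrite cards1.
rewrite (big_pred1 finset.set0) // => D; rewrite /= -cards_eq0.
by case: #|D| => [|[|[|m]]].
Qed.

(** Grid points are grouped by support; supports of size two, one and zero give the three
    summands. *)
Lemma card_small_support : #|{: {J : grid a | small_support J}}| =
  (\sum_(i < n) \sum_(j < n | i < j) a i * a j + \sum_(i < n) a i + 1)%N.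
Proof.
rewrite card_sig -sum1_card (partition_big gsupp (fun D => #|D| <= 2)%N) //=.
transitivity (\sum_(D : {set 'I_n} | (#|D| <= 2)%N) \prod_(i in D) a i)%N.
  apply: eq_bigr => D D2; rewrite -card_support -sum1_card; apply: eq_bigl => J.
  by rewrite !inE /small_support; case: eqP => [->|]; rewrite ?D2 ?andbF.
rewrite sum_sets_le2 finset.big_set0; congr (_ + _ + _)%N.
  apply: eq_bigr => i _; apply: eq_bigr => j ij.
  by rewrite big_setU1 ?big_set1 // inE -val_eqE neq_ltn ij.
by apply: eq_bigr => i _; rewrite big_set1.
Qed.

End SupportCount.

Lemma clear_denominator (B : pzRingType) (A : comPzRingType) (psi : {rmorphism B -> A})
    c b al : psi c * al = psi b -> psi (- b) * 1 + psi c * al = 0.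
Proof. by move=> ->; rewrite rmorphN mulr1 addNr. Qed.

(** * The coordinate ring, its complex points, and its two families of generators *)

Section CoordinateRing.
Variables (R : realType) (n : nat) (a : 'I_n -> nat).
Notation C := R[i].
Notation A := (coord_ring R a).
Notation eqs := (@relations R n a).
Notation lattice := {ffun 'I_n -> nat}.

Lemma coord_unit (J : grid a) : coord_fun R J * gquot_pi eqs (yvar R J) = 1.
Proof.
rewrite -rmorphM -(rmorph1 (gquot_pi eqs)); apply/gquot_eqP/asboolP.
exists [:: (1, xvar R J * yvar R J - 1)]; rewrite big_seq1 mul1r; split=> // cg.
by rewrite inE => /eqP ->; left; exists J.
Qed.

Lemma grid_shift_to_grid (I : lattice) (D : {set 'I_n}) s :
  in_box a (shift I s) -> (forall i, count_mem i s = (i \in D)) ->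
  grid_shift (to_grid a I) D = to_grid a (shift I s).
Proof.
move=> b sD; have bI : in_box a I by exact: shift_box b.
by apply/ffunP=> i; rewrite [LHS]ffunE to_gridE // [RHS]ffunE ffunE sD.
Qed.

Lemma coord_cube (I : lattice) (j k l : 'I_n) : (j < k)%N -> (k < l)%N ->
  in_box a (shift I [:: j; k; l]) ->
  cube_rel (fun I => coord_fun R (to_grid a I)) I j k l.
Proof.
move=> jk kl b; have bI : in_box a I by exact: shift_box b.
have [jk' kl' jl'] : [/\ j != k, k != l & j != l] by rewrite -!val_eqE /=; split; lia.
have gs s (D : {set 'I_n}) : (forall i, (count_mem i s <= count_mem i [:: j; k; l])%N) ->
    (forall i, count_mem i s = (i \in D)) ->
    to_grid a (shift I s) = grid_shift (to_grid a I) D.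
  move=> le sD; rewrite (grid_shift_to_grid _ sD) // => i.
  by apply: leq_trans (b i); rewrite !ffunE leq_add2l.
have key : gquot_pi eqs (cube_eq R (to_grid a I) j k l) = 0.
  rewrite -(rmorph0 (gquot_pi eqs)); apply/gquot_eqP/asboolP.
  exists [:: (1, cube_eq R (to_grid a I) j k l)]; rewrite big_seq1 mul1r subr0; split=> // cg.
  rewrite inE => /eqP ->; right; exists (to_grid a I), j, k, l; split=> //.
  apply/forall_inP => i iD; rewrite to_gridE //.
  apply: leq_trans (b i); rewrite ffunE -addn1 leq_add2l.
  by move: iD; rewrite /= !inE ![i == _]eq_sym => /orP[/orP[]|] ->; lia.
move/eqP: key; rewrite rmorphB subr_eq0 !rmorphD !rmorphM => /eqP.
rewrite /cube_rel /coord_fun.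
rewrite (gs [:: j; l] [set j; l]%SET); first last.
- by move=> i; rewrite !inE /= addn0 [i == j]eq_sym [i == l]eq_sym; case: eqP => // <-;
    rewrite eq_sym (negPf jl').
- by move=> i /=; lia.
rewrite (gs [:: k] [set k]%SET); first last.
- by move=> i; rewrite !inE /= addn0 eq_sym.
- by move=> i /=; lia.
rewrite (gs [:: j; k; l] [set j; k; l]%SET) //; last first.
  move=> i; rewrite !inE /= addn0 ![i == _]eq_sym.
  case: (eqVneq j i) => [<-|_]; first by rewrite eq_sym (negPf jk') eq_sym (negPf jl').
  by case: (eqVneq k i) => [<-|_] //=; rewrite eq_sym (negPf kl').
rewrite (gs [:: j; k] [set j; k]%SET); first last.
- by move=> i; rewrite !inE /= addn0 [i == j]eq_sym [i == k]eq_sym; case: eqP => // <-;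
    rewrite eq_sym (negPf jk').
- by move=> i /=; lia.
rewrite (gs [:: l] [set l]%SET); first last.
- by move=> i; rewrite !inE /= addn0 eq_sym.
- by move=> i /=; lia.
rewrite (gs [:: k; l] [set k; l]%SET); first last.
- by move=> i; rewrite !inE /= addn0 [i == k]eq_sym [i == l]eq_sym; case: eqP => // <-;
    rewrite eq_sym (negPf kl').
- by move=> i /=; lia.
rewrite (gs [:: j] [set j]%SET); first last.
- by move=> i; rewrite !inE /= addn0 eq_sym.
- by move=> i /=; lia.
have -> : grid_shift (to_grid a I) finset.set0 = to_grid a I.
  by rewrite (grid_shift_to_grid (s := [::])) ?shift0 // => i; rewrite inE.
by move=> E; exact: E.
Qed.

Section Point.
Variable f : lattice -> C.
Hypothesis f_neq0 : forall I, in_box a I -> f I != 0.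
Hypothesis f_cube : forall I (j k l : 'I_n), (j < k)%N -> (k < l)%N ->
  in_box a (shift I [:: j; k; l]) -> cube_rel f I j k l.

Definition point_at (i : 'I_(#|{: grid a}| + #|{: grid a}|)) : C :=
  match fintype.split i with
  | inl j => f (of_grid (enum_val j))
  | inr j => (f (of_grid (enum_val j)))^-1
  end.

Notation point_eval := (meval point_at).

Lemma point_eval_x (J : grid a) : point_eval (xvar R J) = f (of_grid J).
Proof.
rewrite mevalXU /point_at -[lshift _ _]/(unsplit (inl _)) unsplitK.
by rewrite enum_rankK.
Qed.

Lemma point_eval_y (J : grid a) : point_eval (yvar R J) = (f (of_grid J))^-1.
Proof.
rewrite mevalXU /point_at -[rshift _ _]/(unsplit (inr _)) unsplitK.
by rewrite enum_rankK.
Qed.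

Lemma point_eval_relation p : eqs p -> point_eval p = 0.
Proof.
case=> [[J ->]|[I [j [k [l [jk kl fI ->]]]]]].
  rewrite mevalB mevalM point_eval_x point_eval_y meval1 divff ?subrr //.
  by apply: f_neq0; exact: of_grid_box.
have [jk' kl' jl'] : [/\ j != k, k != l & j != l] by rewrite -!val_eqE /=; split; lia.
have gs s (D : {set 'I_n}) : (forall i, (i \in D) -> (i \in [set j; k; l]%SET)) ->
    (forall i, count_mem i s = (i \in D)) -> of_grid (grid_shift I D) = shift (of_grid I) s.
  move=> sub sD; apply/ffunP=> i; rewrite [RHS]ffunE sD [LHS]ffunE [X in nat_of_ord X]ffunE.
  rewrite inordK ?ffunE // ltnS.
  case: (boolP (i \in D)) => [/sub iD|_]; last by rewrite addn0 -ltnS ltn_ord.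
  by rewrite addn1; move/forall_inP: fI; apply.
have E : cube_rel f (of_grid I) j k l.
  apply: f_cube => // i; rewrite -(gs [:: j; k; l] [set j; k; l]%SET) //; first exact: of_grid_box.
  move=> i'; rewrite !inE /= addn0 ![i' == _]eq_sym.
  case: (eqVneq j i') => [<-|_]; first by rewrite eq_sym (negPf jk') eq_sym (negPf jl').
  by case: (eqVneq k i') => [<-|_] //=; rewrite eq_sym (negPf kl').
rewrite /cube_eq mevalB !mevalD !mevalM !point_eval_x.
apply/eqP; rewrite subr_eq0; apply/eqP; move: E; rewrite /cube_rel.
have two (x y : 'I_n) : x != y -> forall i, count_mem i [:: x; y] = (i \in [set x; y]%SET).
  move=> xy i; rewrite !inE /= addn0 [i == x]eq_sym [i == y]eq_sym; case: eqP => // <-.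
  by rewrite eq_sym (negPf xy).
have one (x i : 'I_n) : count_mem i [:: x] = (i \in [set x]%SET).
  by rewrite !inE /= addn0 eq_sym.
rewrite -(gs [:: j; l] [set j; l]%SET); [|by move=> i; rewrite !inE => /orP[] ->; rewrite ?orbT|exact: two].
rewrite -(gs [:: k] [set k]%SET); [|by move=> i; rewrite !inE => ->; rewrite ?orbT|exact: one].
rewrite -(gs [:: j; k] [set j; k]%SET); [|by move=> i; rewrite !inE => /orP[] ->; rewrite ?orbT|exact: two].
rewrite -(gs [:: l] [set l]%SET); [|by move=> i; rewrite !inE => ->; rewrite ?orbT|exact: one].
rewrite -(gs [:: k; l] [set k; l]%SET); [|by move=> i; rewrite !inE => /orP[] ->; rewrite ?orbT|exact: two].
rewrite -(gs [:: j] [set j]%SET); [|by move=> i; rewrite !inE => ->; rewrite ?orbT|exact: one].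
rewrite -(gs [:: j; k; l] [set j; k; l]%SET) //; last first.
  move=> i'; rewrite !inE /= addn0 ![i' == _]eq_sym.
  case: (eqVneq j i') => [<-|_]; first by rewrite eq_sym (negPf jk') eq_sym (negPf jl').
  by case: (eqVneq k i') => [<-|_] //=; rewrite eq_sym (negPf kl').
rewrite (_ : f (of_grid I) = f (of_grid (grid_shift I finset.set0))) //.
by rewrite (gs [::]) ?shift0 // => i; rewrite inE.
Qed.

Lemma point_eval_quot p q : gquot_pi eqs p = gquot_pi eqs q -> point_eval p = point_eval q.
Proof.
move/gquot_eqP/asboolP => [s [sG e]]; apply/eqP; rewrite -subr_eq0.
rewrite -mevalB e raddf_sum /= big_seq big1 // => cg cgs.
by rewrite mevalM (point_eval_relation (sG _ cgs)) mulr0.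
Qed.

End Point.

Notation point_eval f := (meval (point_at f)).

Section Family.
Variables (V : finType) (g : V -> grid a).

Definition lift_family : mpoly #|V| C -> ambient R a :=
  mmap (@mpolyC _ C) (fun i => xvar R (g (enum_val i))).

HB.instance Definition _ := GRing.RMorphism.on lift_family.

Definition family_map : {rmorphism mpoly #|V| C -> A} := gquot_pi eqs \o lift_family.

Lemma mp_eval_family p :
  mp_eval (scalar_map R a) (fun v => coord_fun R (g v)) p = family_map p.
Proof.
rewrite /mp_eval /= /lift_family /mmap rmorph_sum; apply: eq_bigr => m _.
rewrite rmorphM; congr (_ * _); rewrite /mmap1 rmorph_prod; apply: eq_bigr => i _.
by rewrite rmorphXn.
Qed.

Lemma fractional_coord v : fractional family_map (coord_fun R (g v)).
Proof.
have -> : coord_fun R (g v) = family_map (mpolyX C (mnm1 (enum_rank v))).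
  by rewrite /= /lift_family mmapX mmap1U enum_rankK.
exact: fractional_image.
Qed.

Lemma point_eval_family f p : point_eval f (lift_family p) = meval (fun i => f (of_grid (g (enum_val i)))) p.
Proof.
rewrite /lift_family /mmap raddf_sum mevalE; apply: eq_bigr => m _ /=.
rewrite mevalM mevalC /mmap1 rmorph_prod; congr (_ * _); apply: eq_bigr => i _.
by rewrite rmorphXn /=; rewrite point_eval_x.
Qed.

(** Fractions are closed under ring operations and under inverses, and the latter accounts for the
    variables y_J. *)
Lemma all_fractional : (forall J, fractional family_map (coord_fun R J)) ->
  forall al : A, fractional family_map al.
Proof.
move=> frJ al; have -> : al = gquot_pi eqs (repr al) by rewrite /gquot_pi reprK.
move: (repr al) => p; rewrite [p]mpolyE rmorph_sum.
elim/big_ind: _ => [||m _].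
- by rewrite -(rmorph0 family_map); exact: fractional_image.
- exact: fractionalD.
rewrite -mul_mpolyC rmorphM; apply: fractionalM.
  have := fractional_image family_map (mpolyC _ (mcoeff m p)).
  by rewrite [family_map _]/= /lift_family mmapC.
rewrite mpolyXE_id rmorph_prod.
elim/big_ind: _ => [||i _].
- by rewrite -(rmorph1 family_map); exact: fractional_image.
- exact: fractionalM.
rewrite rmorphXn; elim: (m i) => [|e IH]; first by rewrite expr0 -(rmorph1 family_map); exact: fractional_image.
rewrite exprS; apply: fractionalM => //.
rewrite -(splitK i); case: (fintype.split i) => j /=.
  by rewrite -(enum_valK j); exact: frJ.
by rewrite -(enum_valK j); exact: fractional_inv (frJ _) (coord_unit _).
Qed.

End Family.

Definition small_family (J : {J : grid a | small_support J}) : grid a := val J.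
Notation psi0 := (family_map small_family).

(** By induction on weight: below a point with three nonzero coordinates a cube relation is solved
    for its top value, dividing by the unit x_I0. *)
Lemma small_family_fractional al : fractional psi0 al.
Proof.
move: al; apply: all_fractional => J; rewrite -(of_gridK J).
move: (of_grid_box J); move: (of_grid J) => I.
move: {2}(weight I) (erefl (weight I)) => w.
elim/ltn_ind: w I => w IH I Iw bI.
have [I2|I2] := boolP (small_support (to_grid a I)).
  exact: (fractional_coord small_family (Sub (to_grid a I) I2 : {J : grid a | small_support J})).
have : (2 < size (lsupp I))%N.
  rewrite ltnNge; apply: contra I2 => I2; rewrite /small_support -size_lsupp_of_grid.
  have -> // : of_grid (to_grid a I) = I.
  by apply/ffunP=> i; rewrite ffunE to_gridE.
case E : (lsupp I) => [|p [|q [|r t]]] // _.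
have [pq qr IE] := lsupp3P E; set I0 := lower I [:: p; q; r] in IE.
have fr s : (size s < 3)%N -> (forall i, (count_mem i s <= count_mem i [:: p; q; r])%N) ->
    fractional psi0 (coord_fun R (to_grid a (shift I0 s))).
  move=> s3 le; apply: (IH (weight (shift I0 s))) => //.
    by rewrite -Iw; exact: weight_lower3 E s3.
  by rewrite -IE in bI; move=> i; apply: leq_trans (bI i); rewrite !ffunE leq_add2l.
have := coord_cube (I := I0) pq qr; rewrite IE /cube_rel IE => /(_ bI) ce.
have f0 := fr [::] isT (fun i => leq0n _); rewrite shift0 in f0.
have f1 := fractional_inv f0 (coord_unit _).
have -> : coord_fun R (to_grid a I) = gquot_pi eqs (yvar R (to_grid a I0)) *
  (coord_fun R (to_grid a (shift I0 [:: p; r])) * coord_fun R (to_grid a (shift I0 [:: q]))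
   + - (coord_fun R (to_grid a (shift I0 [:: p; q])) * coord_fun R (to_grid a (shift I0 [:: r])))
   + - (coord_fun R (to_grid a (shift I0 [:: q; r])) * coord_fun R (to_grid a (shift I0 [:: p])))).
  rewrite ce; set u := coord_fun R (to_grid a I0); set y := gquot_pi _ _.
  have uy : u * y = 1 by exact: coord_unit.
  rewrite -[LHS]mul1r -uy; ring.
by apply: fractionalM => //; apply: fractionalD; first apply: fractionalD;
  try apply: fractionalN; apply: fractionalM; apply: fr => // i /=; lia.
Qed.

(** An element of the kernel vanishes at every complex point, whereas a nonzero polynomial in the
    initial data is nonzero at some point given by [generic_cube_solution]. *)
Lemma small_family_injective b : psi0 b = 0 -> b = 0.
Proof.
move=> b0; apply/eqP; apply: contraT => bN0.
pose V (i : 'I_#|{: {J : grid a | small_support J}}|) := of_grid (small_family (enum_val i)).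
have Vinj : injective V.
  move=> i j /ffunP ij; apply/enum_val_inj/val_inj/ffunP => k.
  by apply: ord_inj; have := ij k; rewrite !ffunE.
have V2 i : (size (lsupp (V i)) <= 2)%N by rewrite size_lsupp_of_grid; exact: valP (enum_val i).
have [f [f0 fc]] := generic_cube_solution a Vinj V2 bN0.
rewrite -(point_eval_family small_family f b) (point_eval_quot f0 fc (q := 0)).
  by rewrite meval0 eqxx.
by rewrite rmorph0.
Qed.

(** Units cannot vanish at a complex point. The tangent solution is the point through which the
    chain of primes for the lower bound on the dimension is drawn. *)
Lemma small_family_unit c u : psi0 c * u = 1 ->
  meval (fun i => tan_solution C (of_grid (small_family (enum_val i)))) c != 0.
Proof.
have -> : u = gquot_pi eqs (repr u) by rewrite /gquot_pi reprK.
move=> uE; have e : gquot_pi eqs (lift_family small_family c * repr u) = gquot_pi eqs 1.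
  by rewrite rmorphM rmorph1.
have t0 I : in_box a I -> tan_solution C I != 0 by move=> _; exact: tan_solution_neq0.
have tc I (j k l : 'I_n) : (j < k)%N -> (k < l)%N -> in_box a (shift I [:: j; k; l]) ->
    cube_rel (tan_solution C) I j k l by move=> jk kl _; exact: tan_solution_cube.
have := point_eval_quot t0 tc e.
rewrite mevalM meval1 point_eval_family => E.
by apply/eqP => z; move: E; rewrite z mul0r => /esym/eqP; rewrite oner_eq0.
Qed.

Lemma coord_ring_domain : integral_domain A.
Proof. exact: fractional_integral_domain small_family_fractional small_family_injective. Qed.

Lemma coord_ring_dim : krull_dim_eq A
  (\sum_(i < n) \sum_(j < n | i < j) a i * a j + \sum_(i < n) a i + 1)%N.
Proof.
rewrite -card_small_support.
apply: (@fractional_krull_dim _ _ _ psi0) small_family_fractional small_family_injective _ _.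
exact: small_family_unit.
Qed.

Variables (theta : 'I_n -> R) (T : {set cell a}).
Hypothesis n_gt0 : (0 < n)%N.
Hypothesis a_gt0 : forall i, (0 < a i)%N.
Hypothesis theta_bound : forall i, 0 < theta i < pi.
Hypothesis theta_incr : forall i j : 'I_n, (i < j)%N -> theta i < theta j.
Hypothesis T_tiling : tiling theta T.

Notation vertT := {J : grid a | J \in vert T}.

Let psiT := family_map (fun J : vertT => val J).

Lemma tiling_sweep : exists L, [/\ sweep (ttile T) (word_of (top a)) L,
  forall v, v \in L -> tvertex T v & forall v, tvertex T v -> v \in L].
Proof.
have [Tsub Tdim [Tbij _ _]] := T_tiling.
have F_box I i k (f : ttile T I i k) : in_box a (shift I [:: i; k]) by case: f.
have V_box I (f : tvertex T I) : in_box a I by case: f.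
have F_edges := ttile_edges R Tsub Tdim.
have E_vert := tedge_vertices R Tsub.
have left_tile := tedge_left_tile theta_bound theta_incr Tsub Tdim Tbij.
have rv_inj := ttile_right_vertex_inj theta_bound theta_incr Tdim Tbij.
have lv_tile := tvertex_left_tile theta_bound theta_incr Tsub Tdim Tbij.
have r_bound := tedge_right_boundary theta_bound theta_incr Tsub Tdim Tbij.
(* The origin is obtained as the start of the first edge of the right boundary, which exists because
   there is a direction and its length is positive. *)
have V0 : tvertex T (lat0 n).
  have e0 : tedge T (lat0 n) (Ordinal n_gt0).
    by apply: r_bound => [i||k|k]; rewrite ?ffunE.
  by have [] := E_vert _ _ e0.
have pt := path_in_top r_bound.
have [L [sL VL]] := sweep_exists F_box F_edges E_vert left_tile rv_inj (full_top a) pt V0.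
exists L; split=> //; exact: (sweep_all_vertices F_box F_edges E_vert V_box rv_inj lv_tile sL).
Qed.

(** For the flip: a cube relation makes x_(I+e_j+e_l) x_(I+e_k) a fraction in terms of the other six
    values, and as both factors are units, each is a fraction once the other is. *)
Lemma tiling_fractional al : fractional psiT al.
Proof.
move: al; apply: all_fractional => J; rewrite -(of_gridK J).
move: (of_grid_box J); move: (of_grid J) => I bI.
have [L [sL LV _]] := tiling_sweep.
pose M I := fractional psiT (coord_fun R (to_grid a I)).
apply: (@good_all n a M) bI; last first.
  apply: (sweep_good sL) => v /LV[_ vT].
  have vT' : to_grid a v \in vert T by rewrite inE.
  exact: (fractional_coord (fun J : vertT => val J) (Sub (to_grid a v) vT' : vertT)).
rewrite /M => {}I j k l jk kl b mI mj ml mjk mkl mjkl.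
have ce := coord_cube jk kl b; rewrite /cube_rel in ce.
have rhs : fractional psiT (coord_fun R (to_grid a (shift I [:: j; l])) *
    coord_fun R (to_grid a (shift I [:: k]))).
  by rewrite ce; apply: fractionalD; first apply: fractionalD; apply: fractionalM.
split=> m.
  have mi := fractional_inv m (coord_unit _).
  have := fractionalM rhs mi; by rewrite -mulrA coord_unit mulr1.
have mi := fractional_inv m (coord_unit _).
have := fractionalM mi rhs; by rewrite mulrCA mulrA coord_unit mul1r.
Qed.

Lemma card_tiling_vertices : (#|{: vertT}| <=
  \sum_(i < n) \sum_(j < n | i < j) a i * a j + \sum_(i < n) a i + 1)%N.
Proof.
have [L [sL _ VL]] := tiling_sweep.
apply: leq_trans (full_size_le (full_top a) sL).
rewrite cardE -(size_map (fun J : vertT => of_grid (val J))); apply: uniq_leq_size.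
  rewrite map_inj_uniq ?enum_uniq // => J J' /ffunP JJ'.
  by apply/val_inj/ffunP => k; apply: ord_inj; have := JJ' k; rewrite !ffunE.
move=> _ /mapP[J _ ->]; apply: VL; split; first exact: of_grid_box.
by rewrite of_gridK; have := valP J; rewrite inE.
Qed.

Lemma tiling_transcendence_basis :
  transcendence_basis (scalar_map R a) (fun J : vertT => coord_fun R (val J)).
Proof.
have [[p chp] _] := coord_ring_dim.
split=> [q|al].
  rewrite (mp_eval_family (fun J : vertT => val J)).
  exact: (long_chain_injective tiling_fractional chp card_tiling_vertices).
have [c [b [[u cu] cal]]] := tiling_fractional al.
(* The linear equation c t - b = 0 for [al]; its leading coefficient is nonzero, being a unit in a
   nonzero ring. *)
exists 2%N, (fun i : 'I_2 => if i == ord0 then - b else c); split.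
  exists (lift ord0 ord0); rewrite (mp_eval_family (fun J : vertT => val J)) /= => c0.
  have [one0 _] := coord_ring_domain; apply: one0.
  have c0' : psiT c = 0 := c0.
  by rewrite -cu c0' mul0r.
rewrite big_ord_recl big_ord1 !(mp_eval_family (fun J : vertT => val J)).
apply: etrans (clear_denominator cal).
by congr (_ + _).
Qed.

End CoordinateRing.

Theorem theorem4p3 (R : realType) (n : nat) (a : 'I_n -> nat)
    (theta : 'I_n -> R)
    (n_ge3 : (3 <= n)%N)
    (a_gt0 : forall i, (0 < a i)%N)
    (theta_bound : forall i, 0 < theta i < pi)
    (theta_incr : forall i j : 'I_n, (i < j)%N -> theta i < theta j) :
  [/\ integral_domain (coord_ring R a),
      krull_dim_eq (coord_ring R a)
        (\sum_(i < n) \sum_(j < n | i < j) a i * a j +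
         \sum_(i < n) a i + 1)%N &
      forall T : {set cell a}, tiling theta T ->
        transcendence_basis (scalar_map R a)
          (fun J : {J : grid a | J \in vert T} => coord_fun R (val J))].
Proof.
have n_gt0 : (0 < n)%N by exact: leq_trans n_ge3.
split; [exact: coord_ring_domain | exact: coord_ring_dim | move=> T tT].
exact: tiling_transcendence_basis n_gt0 a_gt0 theta_bound theta_incr tT.
Qed.
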